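(* Let $n\ge 1$, let $K\subset\mathbb{R}^n$ be a convex bounded set containing the origin and let $f:K\longrightarrow\mathbb{R}_{\geq0}$ be a concave function with $f(0)=|f|_\infty$. Then, for any $0<p<q$, \[ \left(\frac{\binom{n+q}{n}}{\mathrm{G}_{n}(K)}\sum_{x\in K\cap\mathbb{Z}^n}f^{q}(x)\right)^{1/q} \leq\left(\frac{\binom{n+p}{n}}{\mathrm{G}_{n}(K)}\sum_{x\in (K+(-1,1)^n)\cap\mathbb{Z}^n} \bigl(f^{\diamond}\bigr)^{p}(x)\right)^{1/p}. \]
   Context: For $M\subset\mathbb{R}^n$, $\mathrm{G}_n(M)=|M\cap\mathbb{Z}^n|$. $|f|_\infty=\sup_{x\in K}f(x)$. For real $r,s>0$, $\binom{r}{s}=\frac{\Gamma(r+1)}{\Gamma(s+1)\Gamma(r-s+1)}$. For a function $\phi:K\to\mathbb{R}_{\ge0}$, let $\overline{\phi}:\mathbb{R}^n\to\mathbb{R}_{\ge0}$ be given by $\overline{\phi}(x)=\phi(x)$ if $x\in K$ and $\overline{\phi}(x)=0$ otherwise; then $\phi^{\diamond}:K+(-1,1)^n\to\mathbb{R}_{\ge0}$ is defined by $\phi^{\diamond}(z)=\sup_{u\in(-1,1)^n}\overline{\phi}(z+u)$. Sums of sets are Minkowski sums. *)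

(* Defs.v *)
From HB Require Import structures.
From mathcomp Require Import all_boot all_order all_algebra.
From mathcomp Require Import finmap.
From mathcomp Require Import all_classical all_reals all_analysis.

Set Implicit Arguments.
Unset Strict Implicit.
Unset Printing Implicit Defensive.

Import Order.TTheory GRing.Theory Num.Theory.
Import numFieldNormedType.Exports.

Local Open Scope classical_set_scope.
Local Open Scope ring_scope.
Local Open Scope convex_scope.

(* Euler's integral; it converges only for [0 < x], the sole range for which
   this is the Gamma function. *)
Definition Gamma {R : realType} (x : R) : R :=
  \int[lebesgue_measure]_(t in `]0, +oo[) (t `^ (x - 1) * expR (- t)).

(* Meaningful when [-1 < s < r + 1], so that all three Gamma values converge. *)
Definition rbinom {R : realType} (r s : R) : R :=
  Gamma (r + 1) / (Gamma (s + 1) * Gamma (r - s + 1)).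

Definition int_lattice (R : realType) (n : nat) : set 'rV[R]_n :=
  [set x | forall i, x 0 i \is a Num.int].
Arguments int_lattice : clear implicits.

(* [fset_set] sends infinite sets to the empty one, so this is the lattice
   point enumerator for sets with finitely many lattice points, in particular
   for bounded ones. *)
Definition Gn {R : realType} {n : nat} (M : set 'rV[R]_n) : nat :=
  #|` fset_set (M `&` int_lattice R n) |.

Definition open_cube (R : realType) (n : nat) : set 'rV[R]_n :=
  [set u | forall i, -1 < u 0 i < 1].
Arguments open_cube : clear implicits.

Definition minkowski_sum {R : realType} {n : nat} (A B : set 'rV[R]_n)
    : set 'rV[R]_n :=
  [set x + y | x in A & y in B].

(* Mirrors [convex_function], with the inequality reversed. *)
Definition concave_function {R : numFieldType} {E : lmodType R}
    (E' := convex_lmodType E) (D : set E') (f : E' -> R^o) : Prop :=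
  forall t : {i01 R},
    {in D &, forall x y : E', f x <| t |> f y <= f (x <| t |> y)}.

(* Functions on K are represented by total functions of which only the values
   on K matter. The supremum is taken in the extended reals, so that it is
   [+oo] when f is unbounded above on K. *)
Definition sup_on {R : realType} {n : nat} (K : set 'rV[R]_n)
    (f : 'rV[R]_n -> R) : \bar R :=
  ereal_sup [set (f x)%:E | x in K].

Definition zero_ext {R : realType} {n : nat} (K : set 'rV[R]_n)
    (f : 'rV[R]_n -> R) : 'rV[R]_n -> R :=
  patch (fun=> 0) K f.

(* A genuine supremum whenever f is bounded above on K; the real [sup] of a set
   unbounded above is 0. *)
Definition diamond {R : realType} {n : nat} (K : set 'rV[R]_n)
    (f : 'rV[R]_n -> R) (z : 'rV[R]_n) : R :=
  sup [set zero_ext K f (z + u) | u in open_cube R n].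

(* Main.v *)
Require Import Defs.
From mathcomp Require Import all_boot all_order all_algebra.
From mathcomp Require Import finmap.
From mathcomp Require Import all_classical all_reals all_analysis.
From mathcomp Require Import measurable_realfun ring lra.

Set Implicit Arguments.
Unset Strict Implicit.
Unset Printing Implicit Defensive.

Import Order.TTheory GRing.Theory Num.Theory.
Import numFieldNormedType.Exports.

Local Open Scope classical_set_scope.
Local Open Scope ring_scope.

                                                             

(** This is a discrete form of Berwald's inequality, obtained by comparing the level sets of [f]
    with an extremal profile. Let M be the number of lattice points of K, N(t) the number of those
    with f^p >= t, and N'(t) the number of lattice points of K + (-1,1)^n at which the p-th power of
    the diamond of f is >= t. The profile is g_b(t) = M (1 - (t/b)^(1/p))^n for t <= b and 0 beyond.
    With r = q/p, beta integrals give M b / binom(n+p,n) for the integral of g_b and M b^r / (r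
    binom(n+q,n)) for that of t^(r-1) g_b ([beta_integral], [beta_val_rbinom]). By the layer-cake
    formula, the sum of f^q is r times the integral of t^(r-1) N, and the sum on the right-hand side
    is the integral of N'. So it suffices that every b > 0 for which t^(r-1) g_b has smaller
    integral than t^(r-1) N also satisfies: the integral of g_b is at most that of N'
    ([powR_le_of_dominated]).

    This comparison is [single_crossing]. Once g_b(s) <= N(s) at some level s, g_b <= N' at all
    lower levels. Hence there is a level t0 with g_b <= N' below it and N <= g_b above it, while N
    <= N' everywhere. As t^(r-1) increases, t^(r-1) (N - g_b) <= t0^(r-1) (N' - g_b), and
    integration concludes.

    The propagation to lower levels is a discrete Brunn-Minkowski inequality, [card_pow_sum_ge]. For
    t < s put l = (t/s)^(1/p). If x is in K and f(y)^p >= s, concavity gives f((1-l) x + l y) >=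
    t^(1/p). That combination need not be a lattice point, but every lattice point at distance < 1
    from it in each coordinate is counted by N'(t). The origin, where [f] is maximal, keeps all the
    level sets involved nonempty. Brunn-Minkowski itself comes from the line ([card_near_comb])
    through a Prékopa-Leindler inequality whose exponents are independent of the weights; it
    tensorises ([Prekopa_Leindler_tuple]), and a suitable choice of exponents yields the n-th root
    form. *)

Lemma fsbig_finType (S : Type) (idx : S) (op : Monoid.com_law idx)
    (T : finType) (P : pred T) (F : T -> S) :
  \big[op/idx]_(i \in [set i | P i]) F i = \big[op/idx]_(i | P i) F i.
Proof.
rewrite -big_enum/= [RHS]fsbig_seq ?enum_uniq//.
apply: (congr1 (fun A : set T => \big[op/idx]_(i \in A) F i)); apply/seteqP.
by split => i /=; rewrite mem_enum.
Qed.

(** * Discrete Brunn-Minkowski inequality on the line *)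

Lemma natr_close_eq (R : realType) (m n : nat) :
  (m%:R < n%:R + 1 :> R) -> (n%:R < m%:R + 1 :> R) -> m = n.
Proof.
rewrite !natr1 !ltr_nat !ltnS => mn nm.
by apply/eqP; rewrite eqn_leq mn nm.
Qed.

Lemma measure_itvs (R : realType) (T : finType) (P : pred T) (s l : T -> R) :
  (forall i, 0 <= l i) ->
  trivIset [set i | P i] (fun i => `[s i, s i + l i[%classic) ->
  lebesgue_measure (\bigcup_(i in [set i | P i]) `[s i, s i + l i[%classic)
    = (\sum_(i | P i) l i)%:E.
Proof.
move=> l0 tri.
rewrite measure_fin_bigcup//; last exact: finite_finset.
rewrite fsbig_finType -sumEFin; apply: eq_bigr => i _.
apply: etrans (lebesgue_measure_itv _) _; rewrite /= lte_fin.
rewrite ltrDl lt_neqAle l0 andbT eq_sym.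
by case: eqP => [->//|_] /=; rewrite -EFinD; congr EFin; ring.
Qed.

(** The strict bound matches the open cube: [z] differs from the combination by an element of
    (-1,1). *)
Definition near_comb (R : realType) (a b : R) (B : nat) (x y z : 'I_B) :=
  `|z%:R - (a * x%:R + b * y%:R)| < 1.

Section Line.
Context {R : realType}.
Variables (a b : R).
Hypotheses (a0 : 0 < a) (b0 : 0 < b) (ab1 : a + b = 1).

                                                                              
                                                                          
                                      
(** As for Brunn-Minkowski on the line, a X + b min Y and a max X + b Y lie one after the other
    inside a X + b Y. Attach an interval of length [a] to each point of the first set and one of
    length [b] to each point of the second: these are disjoint and their total length is the
    left-hand side. Each lies in some [c, c + 1) with c in a X + b Y, and the integer part of a
    point of [c, c + 1) is at distance < 1 from c, so the unit cells [k, k + 1) with k in [Z] cover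
    everything. *)
Lemma card_near_comb (B : nat) (X Y : pred 'I_B) (x0 y0 : 'I_B) :
  X x0 -> Y y0 ->
  a * #|X|%:R + b * #|Y|%:R
    <= #|[pred k | [exists x, [exists y,
            [&& X x, Y y & near_comb a b x y k]]]]|%:R.
Proof.
move=> Xx Yy; set Z := [pred k | _].
case: (@arg_maxnP _ x0 X (fun i => i : nat) Xx) => x1 Xx1 x1max.
case: (@arg_minnP _ y0 Y (fun i => i : nat) Yy) => y1 Yy1 y1min.
pose P (i : 'I_B + 'I_B) := match i with inl x => X x | inr y => Y y end.
(* The shift [+ a] in the second family makes it start where the last interval of the first family,
   the one at [x1], ends. *)
pose s (i : 'I_B + 'I_B) : R := match i with
  | inl x => a * x%:R + b * y1%:R | inr y => a * x1%:R + b * y%:R + a end.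
pose l (i : 'I_B + 'I_B) := match i with inl x => a | inr y => b end.
have Xle (x : 'I_B) : X x -> a * x%:R <= a * x1%:R.
  by move=> /x1max xx1; rewrite ler_pM2l// ler_nat.
have Yle (y : 'I_B) : Y y -> b * y1%:R <= b * y%:R.
  by move=> /y1min xx1; rewrite ler_pM2l// ler_nat.
have triP : trivIset [set i | P i] (fun i => `[s i, s i + l i[%classic).
  move=> [x|y] [x'|y'] /= + + [w []] /=; rewrite !in_itv/=
    => Pi Pj /andP[h1 h2] /andP[h3 h4].
  - congr inl; apply: val_inj; apply: (@natr_close_eq R).
      by rewrite -(ltr_pM2l a0); lra.
    by rewrite -(ltr_pM2l a0); lra.
  - by exfalso; have := Xle _ Pi; have := Yle _ Pj; lra.
  - by exfalso; have := Xle _ Pj; have := Yle _ Pi; lra.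
  - congr inr; apply: val_inj; apply: (@natr_close_eq R).
      by rewrite -(ltr_pM2l b0); lra.
    by rewrite -(ltr_pM2l b0); lra.
have triZ : trivIset [set k | Z k] (fun k : 'I_B => `[k%:R : R, k%:R + 1[%classic).
  move=> k k' _ _ [w []] /=; rewrite !in_itv/= => /andP[h1 h2] /andP[h3 h4].
  by apply: val_inj; apply: (@natr_close_eq R); lra.
have cov (x y : 'I_B) (w : R) : X x -> Y y ->
    a * x%:R + b * y%:R <= w < a * x%:R + b * y%:R + 1 ->
    (\bigcup_(k in [set k | Z k]) `[k%:R : R, k%:R + 1[%classic) w.
  move=> Xx' Yy' /andP[w1 w2].
  have w0 : 0 <= w.
    by apply: le_trans w1; rewrite addr_ge0// mulr_ge0// ltW.
  have /andP[t1 t2] := truncn_itv w0.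
  (* The integer part is still an index: [x] and [y] are at most B - 1, so [w] < B. *)
  have tB : (Num.truncn w < B)%N.
    rewrite -(ltr_nat R); apply: le_lt_trans t1 _; apply: lt_le_trans w2 _.
    have hx : x%:R + 1 <= B%:R :> R by rewrite natr1 ler_nat ltn_ord.
    have hy : y%:R + 1 <= B%:R :> R by rewrite natr1 ler_nat ltn_ord.
    have hX : a * (x%:R + 1) <= a * B%:R by rewrite ler_pM2l.
    have hY : b * (y%:R + 1) <= b * B%:R by rewrite ler_pM2l.
    have -> : B%:R = a * B%:R + b * B%:R :> R by rewrite -mulrDl ab1 mul1r.
    by move: hX hY; rewrite !mulrDr !mulr1; move: ab1; lra.
  exists (Ordinal tB); rewrite /=.
    apply/existsP; exists x; apply/existsP; exists y; rewrite Xx' Yy' /near_comb/=.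
    move: t2; rewrite -natr1 => t2.
    by rewrite /= ltr_norml; apply/andP; split; lra.
  by rewrite in_itv/= t1/= natr1.
have sub : \bigcup_(i in [set i | P i]) `[s i, s i + l i[%classic
    `<=` \bigcup_(k in [set k | Z k]) `[k%:R : R, k%:R + 1[%classic.
  move=> w [[x|y] /= Pi]; rewrite in_itv/= => /andP[w1 w2].
    by apply: (cov x y1) => //; move: ab1 b0 => ? ?; apply/andP; split; lra.
  by apply: (cov x1 y) => //; move: ab1 a0 => ? ?; apply/andP; split; lra.
have mI (T : finType) (Q : pred T) (u v : T -> R) :
    measurable (\bigcup_(i in [set i | Q i]) `[u i, v i[%classic).
  by apply: fin_bigcup_measurable => //; exact: finite_finset.
have := sub; set A := bigcup _ _; set C := bigcup _ _ => AC.
have : (lebesgue_measure A <= lebesgue_measure C)%E.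
  by apply: le_measure => //; rewrite inE; exact: mI.
rewrite /A /C (@measure_itvs R _ P s l) ?(@measure_itvs R _ Z _ (fun=> 1))//;
  last first.
  by case=> ?; rewrite ltW.
by rewrite lee_fin big_sumType/= !sumr_const -[a *+ _]mulr_natr -[b *+ _]mulr_natr.
Qed.

End Line.

(** * Discrete Prékopa-Leindler inequality: from level sets to sums, then from the line to
    products *)

Lemma weighted_AMGM (R : realType) (m n x y : R) :
  0 < m -> 0 < n -> m + n = 1 -> 0 <= x -> 0 <= y ->
  (x / m) `^ m * (y / n) `^ n <= x + y.
Proof.
move=> m0 n0 mn1 x0 y0.
have hx : 0 <= x / m by rewrite divr_ge0// ltW.
have hy : 0 <= y / n by rewrite divr_ge0// ltW.
have := @conjugate_powR R ((x / m) `^ m) ((y / n) `^ n) m^-1 n^-1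
  (powR_ge0 _ _) (powR_ge0 _ _).
rewrite !invr_gt0 !invrK => /(_ m0 n0 mn1).
rewrite -!powRrM !mulfV ?gt_eqF// !powRr1//.
by rewrite !divfK ?gt_eqF.
Qed.

Section Layers.
Context {R : realType}.
Notation mu := (@lebesgue_measure R).

Lemma card_natr_sum (T : finType) (P Q : pred T) :
  #|[pred x | P x & Q x]|%:R = \sum_(x | P x) (Q x)%:R :> R.
Proof.
rewrite -sum1_card natr_sum big_mkcond [RHS]big_mkcond/=.
by apply: eq_bigr => x _; rewrite inE/=; case: (P x); case: (Q x).
Qed.

Lemma measurable_fun_le_cst (D : set R) (c : R) :
  measurable_fun D (fun t : R => (t <= c)%R%:R : R).
Proof.
rewrite (_ : (fun t : R => _) = \1_(`]-oo, c]%classic)).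
  exact: measurable_indic.
by apply/funext => t; rewrite indicE mem_setE/= in_itv.
Qed.

(** Layer-cake formula with weight [W]. Any common upper bound [C] will do, so that several
    functions can be integrated over one interval. *)
Lemma integral_layers (T : finType) (P : pred T) (u : T -> R) (C : R) (W : R -> R) :
  measurable_fun setT W -> (forall t, 0 <= W t) ->
  (forall x, P x -> u x <= C) ->
  (\int[mu]_(t in `]0%R, C]) (W t * #|[pred x | P x & t <= u x]|%:R)%:E
    = \sum_(x | P x) \int[mu]_(t in `]0%R, u x]) (W t)%:E)%E.
Proof.
move=> mW W0 uC.
transitivity (\int[mu]_(t in `]0%R, C])
    (\sum_(x <- index_enum T | P x) (W t * (t <= u x)%R%:R)%:E))%E.
  apply: eq_integral => t _.
  by rewrite card_natr_sum mulr_sumr sumEFin.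
rewrite -(big_filter (index_enum T)).
under eq_integral do rewrite -big_filter.
rewrite ge0_integral_sum//; last 2 first.
- move=> x; apply/measurable_EFinP; apply: measurable_funM.
    exact: measurable_funTS.
  exact: measurable_fun_le_cst.
- by move=> x t _; rewrite lee_fin mulr_ge0// ler0n.
rewrite big_seq [RHS]big_seq; apply: eq_bigr => x; rewrite mem_filter => /andP[Px _].
rewrite (_ : `]0, u x]%classic = `]0, C]%classic `&` `]-oo, u x]%classic);
  last first.
  apply/seteqP; split => t /=; rewrite !in_itv/= ?andbT.
    by move=> /andP[-> tu]; rewrite tu (le_trans tu) ?uC.
  by move=> [/andP[-> _] ->].
rewrite integral_mkcondr; apply: eq_integral => t _.
by rewrite /patch mem_setE in_itv/=; case: leP => _; rewrite ?mulr1 ?mulr0.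
Qed.

Lemma measurable_layers (T : finType) (P : pred T) (u : T -> R) (D : set R) :
  measurable_fun D (fun t : R => #|[pred x | P x & t <= u x]|%:R : R).
Proof.
under eq_fun do rewrite card_natr_sum big_mkcond/=.
apply: measurable_sum => x; case: (P x) => //; exact: measurable_fun_le_cst.
Qed.

(** Integrate the hypothesis over the levels in (0, 1]. Nothing is known above level 1, so [w] is
    truncated there, which can only decrease its sum. *)
Lemma sum_layers_le (T1 T2 T3 : finType) (a b : R)
    (u : T1 -> R) (v : T2 -> R) (w : T3 -> R) :
  0 <= a -> 0 <= b ->
  (forall x, 0 <= u x <= 1) -> (forall x, 0 <= v x <= 1) -> (forall x, 0 <= w x) ->
  (forall t, 0 < t <= 1 ->
     a * #|[pred x | t <= u x]|%:R + b * #|[pred x | t <= v x]|%:R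
       <= #|[pred x | t <= w x]|%:R) ->
  a * (\sum_x u x) + b * (\sum_x v x) <= \sum_x w x.
Proof.
move=> a0 b0 u01 v01 w0 H.
pose w' x := Num.min 1 (w x).
apply: (@le_trans _ _ (\sum_x w' x)); last first.
  by apply: ler_sum => x _; rewrite ge_min lexx orbT.
pose L (T : finType) (g : T -> R) (t : R) : R :=
  #|[pred x : T | true & t <= g x]|%:R.
have EL (T : finType) (g : T -> R) : (forall x, 0 <= g x <= 1) ->
    (\int[mu]_(t in `]0%R, 1%R]) (L T g t)%:E = (\sum_x g x)%:E)%E.
  move=> g01.
  have := @integral_layers T xpredT g 1 (fun=> 1) (measurable_cst _) (fun=> ler01).
  under eq_integral do rewrite mul1r.
  move=> ->; last by move=> x _; case/andP: (g01 x).
  rewrite -sumEFin; apply: eq_bigr => x _.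
  rewrite integral_cst//= mul1e.
  rewrite lebesgue_measure_itv/= lte_fin sube0.
  have /andP[g0 _] := g01 x.
  by case: ltP => // gx; congr EFin; apply/eqP; rewrite eq_le g0.
have mL (T : finType) (g : T -> R) (D : set R) :
    measurable_fun D (fun t => (L T g t)%:E).
  by apply/measurable_EFinP; exact: measurable_layers.
rewrite -lee_fin EFinD !EFinM -EL// -EL// -EL; last first.
  by move=> x; rewrite /w' le_min ler01 w0/= ge_min lexx.
rewrite -!ge0_integralZl_EFin//; do ?by move=> t _; rewrite lee_fin.
rewrite -ge0_integralD//; last 4 first.
- by move=> t _; rewrite -EFinM lee_fin mulr_ge0.
- by apply: measurable_funeM; exact: mL.
- by move=> t _; rewrite -EFinM lee_fin mulr_ge0.
- by apply: measurable_funeM; exact: mL.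
apply: ge0_le_integral => //=.
- by move=> t _; rewrite -!EFinM -EFinD lee_fin addr_ge0// mulr_ge0.
- by apply: emeasurable_funD; apply: measurable_funeM; exact: mL.
- exact: mL.
- move=> t; rewrite in_itv/= => t01; rewrite -!EFinM -EFinD lee_fin.
  apply: le_trans (H t t01) _; rewrite ler_nat.
  apply/subset_leq_card/fintype.subsetP => x.
  by rewrite !inE/= /w' le_min => ->; case/andP: t01 => _ ->.
- exact: mL.
- exact: mL.
Qed.

End Layers.

(** The exponents [m] and [n] are separate from the weights of the convex combination, which are
    hidden in [r]; the constant [c] pays for the discrepancy. Leaving [r] abstract lets the property
    pass to products. *)
Definition Prekopa_Leindler {R : realType} (T : finType) (r : T -> T -> T -> bool)
    (m n c : R) := forall f g h : T -> R,
  (forall x, 0 <= f x) -> (forall x, 0 <= g x) -> (forall x, 0 <= h x) ->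
  (forall x y z, r x y z -> f x `^ m * g y `^ n <= h z) ->
  c * ((\sum_x f x) `^ m * (\sum_x g x) `^ n) <= \sum_x h x.

Lemma sumr_argmax (R : realType) (T : finType) (f : T -> R) :
  (forall x, 0 <= f x) -> \sum_x f x != 0 ->
  exists x0, 0 < f x0 /\ forall x, f x <= f x0.
Proof.
move=> f0; rewrite psumr_eq0// => /allPn[x _ /= fx0].
case: (@Order.TotalTheory.arg_maxP _ _ _ x xpredT f isT) => x0 _ fmax.
exists x0; split => [|y]; last exact: fmax.
by apply: lt_le_trans (fmax x isT); rewrite lt_neqAle eq_sym fx0 f0.
Qed.

Section PrekopaLeindler.
Context {R : realType}.
Variables (m n : R).
Hypotheses (m0 : 0 < m) (n0 : 0 < n) (mn1 : m + n = 1).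

(** Divide [f] and [g] by their maxima F and G, and [h] by F^m G^n. For t <= 1 both level sets are
    nonempty, and since m + n = 1 points related to them have normalised [h] at least t. The count
    on the line with weights [a], [b] then bounds an arithmetic combination of the sums, and AM-GM
    with weights [m], [n] makes it a product with constant (a/m)^m (b/n)^n. *)
Lemma Prekopa_Leindler_line (a b : R) (B : nat) :
  0 < a -> 0 < b -> a + b = 1 ->
  Prekopa_Leindler (@near_comb R a b B) m n ((a / m) `^ m * (b / n) `^ n).
Proof.
move=> a0 b0 ab1 f g h f0 g0 h0 fgh.
have sumh0 : 0 <= \sum_x h x by apply: sumr_ge0.
have [->|/(sumr_argmax f0)[x0 [fx0 fmax]]] := eqVneq (\sum_x f x) 0.
  by rewrite powR0 ?gt_eqF// mul0r mulr0.
have [->|/(sumr_argmax g0)[y0 [gy0 gmax]]] := eqVneq (\sum_x g x) 0.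
  by rewrite powR0 ?gt_eqF// !mulr0.
set F := f x0 in fx0 fmax; set G := g y0 in gy0 gmax.
set K := F `^ m * G `^ n.
have K0 : 0 < K by rewrite mulr_gt0 ?powR_gt0.
have [F0 G0] : 0 <= F /\ 0 <= G by rewrite !ltW.
have : a * (\sum_x f x / F) + b * (\sum_x g x / G) <= \sum_x h x / K.
  apply: sum_layers_le.
  - exact: ltW.
  - exact: ltW.
  - by move=> x; rewrite divr_ge0//= ler_pdivrMr ?mul1r.
  - by move=> x; rewrite divr_ge0//= ler_pdivrMr ?mul1r.
  - by move=> x; rewrite divr_ge0// ltW.
  move=> t /andP[t0 t1].
  have := @card_near_comb R a b a0 b0 ab1 B (fun x => t <= f x / F)
    (fun y => t <= g y / G) x0 y0.
  rewrite !divff ?gt_eqF// => /(_ t1 t1) /le_trans; apply.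
  rewrite ler_nat; apply/subset_leq_card/fintype.subsetP => z; rewrite !inE.
  move=> /existsP[x /existsP[y /and3P[tx ty xyz]]].
  rewrite ler_pdivlMr//; apply: le_trans (fgh _ _ _ xyz).
  move: tx ty; rewrite !ler_pdivlMr// => tx ty.
  have -> : t * K = (t * F) `^ m * (t * G) `^ n.
    rewrite !powRM ?ltW//  mulrACA -powRD ?mn1 ?powRr1 ?ltW//.
    by rewrite oner_eq0.
  by apply: ler_pM; rewrite ?powR_ge0//; apply: ge0_ler_powR;
    rewrite ?nnegrE ?mulr_ge0// ?ltW.
rewrite -!mulr_suml ler_pdivlMr// => ineq; apply: le_trans ineq.
have S0 (T : finType) (k : T -> R) : (forall x, 0 <= k x) -> 0 <= \sum_x k x.
  by move=> k0; apply: sumr_ge0.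
have af0 : 0 <= a * ((\sum_x f x) / F).
  by rewrite mulr_ge0 ?(ltW a0) ?(ltW b0)// divr_ge0 ?S0.
have bg0 : 0 <= b * ((\sum_x g x) / G).
  by rewrite mulr_ge0 ?(ltW a0) ?(ltW b0)// divr_ge0 ?S0.
apply: le_trans (ler_wpM2r (ltW K0) (weighted_AMGM m0 n0 mn1 af0 bg0)).
have am : 0 <= a / m by rewrite divr_ge0 ?ltW.
have bn : 0 <= b / n by rewrite divr_ge0 ?ltW.
have afm := divr_ge0 af0 (ltW m0).
have bgn := divr_ge0 bg0 (ltW n0).
have [Sf Sg] := (S0 _ f f0, S0 _ g g0).
rewrite /K mulrACA [leRHS]mulrACA -(powRM _ am Sf) -(powRM _ bn Sg).
rewrite -(powRM _ afm F0) -(powRM _ bgn G0).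
rewrite le_eqVlt; apply/orP; left; apply/eqP.
by congr (_ `^ _ * _ `^ _); field; rewrite ?gt_eqF.
Qed.

(** Fubini: the inequality on [T], applied to the sections over related x, y, z, says that the
    marginals of [f] and [g], with the marginal of [h] divided by [d], satisfy the hypothesis on
    [S]. *)
Lemma Prekopa_Leindler_prod (S T : finType) (r : S -> S -> S -> bool)
    (s : T -> T -> T -> bool) (c d : R) : 0 < d ->
  Prekopa_Leindler r m n c -> Prekopa_Leindler s m n d ->
  Prekopa_Leindler (fun x y z => r x.1 y.1 z.1 && s x.2 y.2 z.2) m n (c * d).
Proof.
move=> d0 PLr PLs f g h f0 g0 h0 fgh.
have pairE (k : S * T -> R) : \sum_p k p = \sum_x \sum_y k (x, y).
  by rewrite pair_bigA; apply: eq_bigr => -[].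
rewrite !pairE.
have := PLr (fun x => \sum_y f (x, y)) (fun x => \sum_y g (x, y))
  (fun x => (\sum_y h (x, y)) / d).
rewrite -mulr_suml ler_pdivlMr// => PL.
rewrite mulrAC; apply: PL => [x|x|x|x y z rxyz].
- by apply: sumr_ge0.
- by apply: sumr_ge0.
- by rewrite divr_ge0 ?sumr_ge0// ltW.
rewrite ler_pdivlMr// mulrC; apply: PLs => // x' y' z' s'.
by apply: fgh => /=; rewrite rxyz.
Qed.

Lemma Prekopa_Leindler_bij (S T : finType) (r : S -> S -> S -> bool)
    (s : T -> T -> T -> bool) (c : R) (e : S -> T) : bijective e ->
  (forall x y z, r x y z -> s (e x) (e y) (e z)) ->
  Prekopa_Leindler r m n c -> Prekopa_Leindler s m n c.
Proof.
move=> e_bij rs PL f g h f0 g0 h0 fgh.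
have sumE (k : T -> R) : \sum_y k y = \sum_x k (e x).
  by rewrite (reindex e)//; exact: onW_bij.
by rewrite !sumE; apply: PL => // x y z /rs; exact: fgh.
Qed.

Lemma Prekopa_Leindler_tuple (T : finType) (r : T -> T -> T -> bool) (c : R) k :
  0 < c -> Prekopa_Leindler r m n c ->
  Prekopa_Leindler (fun x y z : k.-tuple T =>
    [forall i, r (tnth x i) (tnth y i) (tnth z i)]) m n (c ^+ k).
Proof.
move=> c0 PL; elim: k => [|k IH].
  move=> f g h f0 g0 h0 fgh; rewrite expr0 mul1r.
  have sumE (k : 0.-tuple T -> R) : \sum_x k x = k [tuple].
    by rewrite (big_pred1 [tuple])// => x; apply/esym/eqP/tuple0.
  by rewrite !sumE; apply: fgh; apply/forallP => -[].
pose e (p : T * k.-tuple T) : k.+1.-tuple T := [tuple of p.1 :: p.2].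
apply: (@Prekopa_Leindler_bij _ _ _ _ _ e); last first.
  by rewrite exprS; apply: Prekopa_Leindler_prod PL IH; rewrite exprn_gt0.
- move=> x y z /andP[rxyz /forallP s]; apply/forallP => i.
  case: (unliftP ord0 i) => [j|] ->; last by rewrite !tnth0.
  by rewrite !tnthS.
exists (fun t => (thead t, [tuple of behead t])) => [[x t]|t].
  by rewrite /e/= theadE; congr pair; apply: val_inj.
by rewrite /e/=; apply/esym/tuple_eta.
Qed.
End PrekopaLeindler.

(** * Discrete Brunn-Minkowski inequality in dimension n, in n-th root form *)

Lemma powR_ratio_combine (R : realType) (m n s u v : R) :
  0 < s -> 0 < u -> 0 < v -> m + n = 1 ->
  (s / u) `^ m * (s / v) `^ n * (u `^ m * v `^ n) = s.
Proof.
move=> s0 u0 v0 mn1; have [[uW vW] sW] := (ltW u0, ltW v0, ltW s0).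
rewrite mulrACA -(powRM _ (divr_ge0 sW uW) uW) -(powRM _ (divr_ge0 sW vW) vW).
rewrite (divfK (lt0r_neq0 u0)) (divfK (lt0r_neq0 v0)).
by rewrite -powRD mn1 ?powRr1 ?oner_eq0.
Qed.

(** Prékopa-Leindler applied to the three indicator functions, with exponents adapted to the
    cardinalities of [X] and [Y]. *)
Lemma card_pow_sum_ge (R : realType) (a b : R) (B k : nat)
    (X Y Z : pred (k.+1.-tuple 'I_B)) :
  0 < a -> 0 < b -> a + b = 1 -> (0 < #|X|)%N -> (0 < #|Y|)%N ->
  (forall x y z, X x -> Y y ->
     (forall i, near_comb a b (tnth x i) (tnth y i) (tnth z i)) -> Z z) ->
  (a * #|X|%:R `^ k.+1%:R^-1 + b * #|Y|%:R `^ k.+1%:R^-1) ^+ k.+1 <= #|Z|%:R.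
Proof.
move=> a0 b0 ab1 X0 Y0 XYZ.
set u := #|X|%:R `^ _; set v := #|Y|%:R `^ _; set s := a * u + b * v.
have u0 : 0 < u by rewrite powR_gt0// ltr0n.
have v0 : 0 < v by rewrite powR_gt0// ltr0n.
have uX : #|X|%:R = u ^+ k.+1.
  by rewrite -powR_mulrn ?powR_ge0// -powRrM mulVf ?pnatr_eq0// powRr1.
have vY : #|Y|%:R = v ^+ k.+1.
  by rewrite -powR_mulrn ?powR_ge0// -powRrM mulVf ?pnatr_eq0// powRr1.
have s0 : 0 < s by rewrite addr_gt0// mulr_gt0.
(* With these exponents a/m = s/u and b/n = s/v, so the constant times u^m v^n collapses to s^(m+n)
   = s in each coordinate. *)
pose m := a * u / s; pose n := b * v / s.
have m0 : 0 < m by rewrite divr_gt0// mulr_gt0.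
have n0 : 0 < n by rewrite divr_gt0// mulr_gt0.
have mn1 : m + n = 1 by rewrite -mulrDl divff ?gt_eqF.
have c0 : 0 < (a / m) `^ m * (b / n) `^ n.
  by rewrite mulr_gt0// powR_gt0// divr_gt0.
have sumE (P : pred (k.+1.-tuple 'I_B)) : \sum_x (P x)%:R = #|P|%:R :> R.
  by rewrite -sum1_card natr_sum [RHS]big_mkcond; apply: eq_bigr => x _;
    rewrite unfold_in; case: (P x).
have := @Prekopa_Leindler_tuple R m n _ _ _ k.+1 c0
  (Prekopa_Leindler_line m0 n0 mn1 a0 b0 ab1)
  (fun x => (X x)%:R) (fun x => (Y x)%:R) (fun x => (Z x)%:R)
  (fun=> ler0n _ _) (fun=> ler0n _ _) (fun=> ler0n _ _).
rewrite !sumE uX vY => PL.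
apply: le_trans (PL _); last first.
  move=> x y z /forallP xyz.
  case: (boolP (X x)) => Xx; last by rewrite powR0 ?gt_eqF// mul0r.
  case: (boolP (Y y)) => Yy; last by rewrite [X in _ * X]powR0 ?gt_eqF// mulr0.
  by rewrite (XYZ x y z)// !powR1 mulr1.
have pXn (x e : R) : 0 < x -> (x ^+ k.+1) `^ e = (x `^ e) ^+ k.+1.
  move=> x0; rewrite -powR_mulrn ?ltW// -powRrM mulrC powRrM.
  by rewrite powR_mulrn// powR_ge0.
rewrite !pXn// -!exprMn le_eqVlt; apply/orP; left; apply/eqP; congr (_ ^+ _).
have -> : a / m = s / u by rewrite /m; field; rewrite ?gt_eqF.
have -> : b / n = s / v by rewrite /n; field; rewrite ?gt_eqF.
exact/esym/powR_ratio_combine.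
Qed.

                                 

(** * Beta integrals with integer second exponent *)

Section BetaIntegral.
Context {R : realType}.
Notation mu := (@lebesgue_measure R).

Lemma powR_cvg_at_right0 (c : R) : 0 <= c -> (t `^ c) @[t --> 0^'+] --> (0 `^ c : R).
Proof.
rewrite le_eqVlt => /predU1P[<-|c0].
  by under eq_fun do rewrite powRr0; rewrite powRr0; exact: cvg_cst.
by rewrite powR0 ?gt_eqF//; exact: powR_cvg0.
Qed.

Lemma continuous_powR (c t : R) : 0 < t -> {for t, continuous (fun t => t `^ c)}.
Proof.
move=> t0; apply/differentiable_continuous/derivable1_diffP.
by apply: derivable_powR; rewrite in_itv/= t0.
Qed.

Definition beta_fun (m b c : R) (n : nat) (t : R) : R :=
  t `^ c * (1 - t `^ m / b `^ m) ^+ n.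

(** The value of the integral of [beta_fun] over (0, b]. By the substitution t = b x^(1/m) it is
    (b^(c+1) / m) Beta((c+1)/m, n+1), written here as a finite product. *)
Definition beta_val (m b c : R) (n : nat) : R :=
  b `^ (c + 1) * n`!%:R * m ^+ n / \prod_(i < n.+1) (c + 1 + i%:R * m).

Lemma beta_fun_cvg_at_right0 (m b c : R) (n : nat) : 0 < m -> 0 <= c ->
  beta_fun m b c n t @[t --> 0^'+] --> beta_fun m b c n 0.
Proof.
move=> m0 c0; apply: cvgM; first exact: powR_cvg_at_right0.
apply: (@cvg_comp _ _ _ _ (fun x : R => x ^+ n)); last exact: exprn_continuous.
apply: cvgB; first exact: cvg_cst.
by apply: cvgM; [exact/powR_cvg_at_right0/ltW|exact: cvg_cst].
Qed.

(** Induction on [n], which is integration by parts: differentiating the power of 1 - (t/b)^m lowers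
    [n] by one and raises [c] to c + m. The boundary term vanishes at 0 because of the factor
    t^(c+1), and at [b] because 1 - (b/b)^m = 0. *)
Lemma beta_primitive (m b c : R) (n : nat) : 0 < m -> 0 < b -> 0 <= c ->
  exists F : R -> R, [/\ forall t : R, 0 < t -> is_derive t 1 F (beta_fun m b c n t),
    F t @[t --> 0^'+] --> F 0, F 0 = 0 & F b = beta_val m b c n].
Proof.
move=> m0 b0; have bm0 : b `^ m != 0 by rewrite gt_eqF ?powR_gt0.
elim: n c => [|n IH] c c0.
  have c1 : 0 < c + 1 by rewrite ltr_wpDl.
  exists (fun t => (c + 1)^-1 * t `^ (c + 1)); split.
  - move=> t t0.
    have h := is_deriveZ (c + 1)^-1 (is_derive1_powR (c + 1) t0).
    apply: (is_derive_eq h).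
    by rewrite /beta_fun expr0 mulr1 scalerA mulVf ?gt_eqF// scale1r addrK.
  - by apply: cvgM; [exact: cvg_cst|exact/powR_cvg_at_right0/ltW].
  - by rewrite powR0 ?mulr0 ?gt_eqF.
  - rewrite /beta_val big_ord_recl big_ord0 fact0 expr0 mul0r addr0 !mulr1.
    by rewrite mulrC.
have [F [dF F0r F0 Fb]] := IH (c + m) (addr_ge0 c0 (ltW m0)).
have c1 : 0 < c + 1 by rewrite ltr_wpDl.
pose k : R := n.+1%:R * m / b `^ m.
exists (fun t => (c + 1)^-1 *
  (t `^ (c + 1) * (1 - t `^ m / b `^ m) ^+ n.+1 + k * F t)).
split.
- move=> t t0; have := dF t t0 => dFt.
  have h1 := is_derive1_powR (c + 1) t0.
  have h2 := is_derive1_powR m t0.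
  have h3 := is_deriveX n.+1
    (is_deriveB (is_derive_cst (1 : R) t 1) (is_deriveZ (b `^ m)^-1 h2)).
  have h := is_deriveZ (c + 1)^-1 (is_deriveD (is_deriveM h1 h3) (is_deriveZ k dFt)).
  move: h; set G := (X in is_derive _ _ X _) => h.
  rewrite (_ : (fun t : R => _) = G); last first.
    apply/funext => x; rewrite /G !fctE/=.
    by rewrite [_ / _]mulrC.
  apply: (is_derive_eq h).
  have e : t `^ (c + m) = t `^ (c + 1) * t `^ (m - 1).
    by rewrite -powRD ?(gt_eqF t0) ?implybT//; congr (_ `^ _); ring.
  rewrite /beta_fun /k e addrK !fctE /= -![_ *: _]/(_ * _) exprS.
  rewrite -(mulrC (t `^ m)) sub0r; set w := (1 - _) ^+ n.
  by rewrite exprS -/w; field; rewrite bm0 gt_eqF.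
- apply: cvgM; first exact: cvg_cst.
  apply: cvgD; last by apply: cvgM => //; exact: cvg_cst.
  exact: beta_fun_cvg_at_right0 (ltW c1).
- by rewrite F0 powR0 ?gt_eqF// mul0r mulr0 addr0 mulr0.
- rewrite divff// subrr expr0n/= mulr0 add0r Fb /beta_val /k.
  rewrite [in RHS]big_ord_recl mul0r addr0 factS natrM.
  rewrite (_ : \prod_(i < n.+1) (c + 1 + (lift ord0 i)%:R * m) =
    \prod_(i < n.+1) (c + 1 + m + i%:R * m)); last first.
    by apply: eq_bigr => i _; rewrite lift0 -natr1; ring.
  rewrite (_ : c + m + 1 = c + 1 + m); last by ring.
  rewrite [b `^ (c + 1 + m)]powRD; last by rewrite (gt_eqF b0) implybT.
  have : \prod_(i < n.+1) (c + 1 + m + i%:R * m) != 0.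
    rewrite gt_eqF// prodr_gt0// => i _.
    by apply: ltr_wpDr; [rewrite mulr_ge0 ?ler0n// ltW|rewrite addr_gt0].
  move=> P0; rewrite exprS; set P := \prod_(i < _) _ in P0 *; field; rewrite bm0 P0.
  by rewrite gt_eqF.
Qed.

Lemma continuous_beta_fun (m b c t : R) (n : nat) : 0 < t ->
  {for t, continuous (beta_fun m b c n)}.
Proof.
move=> t0; apply: cvgM; first exact: continuous_powR.
apply: (@cvg_comp _ _ _ _ (fun x : R => x ^+ n)); last exact: exprn_continuous.
apply: cvgB; first exact: cvg_cst.
by apply: cvgM; [exact: continuous_powR|exact: cvg_cst].
Qed.

Lemma measurable_beta_fun (m b c : R) (n : nat) (D : set R) :
  measurable_fun D (beta_fun m b c n).
Proof.
apply: measurable_funM; first exact: (measurable_funTS (measurable_powR c)).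
apply: measurable_funX; apply: measurable_funB => //.
by apply: measurable_funM => //; exact: (measurable_funTS (measurable_powR m)).
Qed.

Lemma beta_integral (m b c : R) (n : nat) : 0 < m -> 0 < b -> 0 <= c ->
  (\int[mu]_(t in `]0%R, b]) (beta_fun m b c n t)%:E = (beta_val m b c n)%:E)%E.
Proof.
move=> m0 b0 c0.
have [F [dF F0r F0 Fb]] := beta_primitive n m0 b0 c0.
rewrite integral_itv_obnd_cbnd; last first.
  apply/measurable_EFinP. exact: measurable_beta_fun.
rewrite (@continuous_FTC2 _ (beta_fun m b c n) F 0 b)//;
  first by rewrite F0 Fb sube0.
- apply/continuous_within_itvP => //; split.
  + by move=> t; rewrite in_itv/= => /andP[t0 _]; exact: continuous_beta_fun.
  + exact: beta_fun_cvg_at_right0.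
  + exact/cvg_at_left_filter/continuous_beta_fun.
- split => //.
  + by move=> t; rewrite in_itv/= => /andP[t0 _]; have [] := dF t t0.
  + apply: cvg_at_left_filter; apply: differentiable_continuous.
    by apply/derivable1_diffP; have [] := dF b b0.
- move=> t; rewrite in_itv/= => /andP[t0 _].
  by rewrite derive1E; have [_ ->] := dF t t0.
Qed.

End BetaIntegral.

(** * The Gamma function at arguments at least 1, and the binomial coefficient *)

Section GammaFunction.
Context {R : realType}.
Notation mu := (@lebesgue_measure R).

Lemma is_derive_expRM (k t : R) :
  is_derive t 1 (fun t => expR (k * t)) (k * expR (k * t)).
Proof.
have h := @is_derive1_comp _ expR (fun t : R => k * t) t _ _
  (is_derive_expR (k * t)) (is_deriveZ k (is_derive_id t 1)).
by apply: (is_derive_eq h); rewrite -![_ *: _]/(_ * _) mulr1 mulrC.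
Qed.

Lemma continuous_expRM (k : R) : continuous (fun t : R => expR (k * t)).
Proof.
move=> t; apply: differentiable_continuous; apply/derivable1_diffP.
by have [] := is_derive_expRM k t.
Qed.

Lemma measurable_expRM (k : R) (D : set R) :
  measurable_fun D (fun t : R => expR (k * t)).
Proof.
apply: measurable_funTS; apply: continuous_measurable_fun => t.
exact: continuous_expRM.
Qed.

Lemma cvgy_expRM (k : R) : 0 < k -> expR (- k * t) @[t --> +oo] --> (0 : R).
Proof.
move=> k0; under eq_fun do rewrite mulNr.
apply: (@cvg_comp _ _ _ (fun t => k * t) (fun t => expR (- t)));
  last exact: cvgr_expR.
by apply: gt0_cvgMry => //; exact: cvg_id.
Qed.

Lemma integral_expRM (k : R) : 0 < k ->
  (\int[mu]_(t in `]0%R, +oo[) (expR (- k * t))%:E = (k^-1)%:E)%E.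
Proof.
move=> k0; have cf := @continuous_expRM (- k).
rewrite integral_itv_obnd_cbnd; last first.
  by apply/measurable_EFinP; exact: measurable_expRM.
have dF (t : R) : is_derive t 1 (fun t => - k^-1 * expR (- k * t)) (expR (- k * t)).
  have h := is_deriveZ (- k^-1) (is_derive_expRM (- k) t).
  apply: (is_derive_eq h); rewrite -![_ *: _]/(_ * _).
  by field; rewrite gt_eqF.
rewrite (@ge0_continuous_FTC2y _ (fun t => expR (- k * t))
  (fun t => - k^-1 * expR (- k * t)) 0 0).
- by rewrite mulr0 expR0 mulr1 sub0e -EFinN opprK.
- by move=> t _; exact: expR_ge0.
- exact: continuous_subspaceT.
- by rewrite -(mulr0 (- k^-1)); apply: cvgM; [exact: cvg_cst|exact: cvgy_expRM].
- by move=> t _; have [] := dF t.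
- apply: cvg_at_right_filter; apply: cvgM; first exact: cvg_cst.
  exact: cf.
- by move=> t _; rewrite derive1E; have [_ ->] := dF t.
Qed.

(** The inequality 1 + x <= exp x at x = t/(2c), raised to the power [c], gives t^c <= (2c)^c
    exp(t/2). The result is an integrable majorant of the Gamma integrand which also tends to 0 at
    infinity. *)
Lemma powR_le_expR (c : R) : 0 <= c ->
  exists2 C : R, 0 <= C &
    forall t : R, 0 < t -> t `^ c * expR (- t) <= C * expR (- 2^-1 * t).
Proof.
move=> c0.
have sufC C : (forall t : R, 0 < t -> t `^ c <= C * expR (2^-1 * t)) ->
    forall t : R, 0 < t -> t `^ c * expR (- t) <= C * expR (- 2^-1 * t).
  move=> H t t0.
  have -> : - 2^-1 * t = 2^-1 * t + - t by field.
  by rewrite expRD mulrA ler_wpM2r ?expR_ge0// H.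
move: c0 sufC; rewrite le_eqVlt => /predU1P[<-|c0] sufC.
  exists 1 => //; apply: sufC => t t0.
  by rewrite powRr0 mul1r -expR0 ler_expR mulr_ge0// ltW.
exists ((2 * c) `^ c); first exact: powR_ge0.
apply: sufC => t t0.
have d0 : 0 < 2 * c by rewrite mulr_gt0.
have -> : expR (2^-1 * t) = expR (t / (2 * c)) `^ c.
  by rewrite -expRM; congr expR; field; rewrite gt_eqF.
rewrite -powRM ?expR_ge0 ?(ltW d0)//.
apply: ge0_ler_powR;
  rewrite ?nnegrE ?mulr_ge0 ?expR_ge0 ?(ltW d0) ?(ltW c0) ?(ltW t0)//.
rewrite mulrC -ler_pdivrMr//; apply: le_trans (expR_ge1Dx _).
by rewrite lerDr.
Qed.

Definition Gamma_integrand (c t : R) : R := t `^ c * expR (- t).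

Notation I c := (\int[mu]_(t in `]0%R, +oo[) (Gamma_integrand c t)%:E)%E.

Lemma measurable_Gamma_integrand c (D : set R) : measurable_fun D (Gamma_integrand c).
Proof.
apply: measurable_funM; first by apply: measurable_funTS; exact: measurable_powR.
under eq_fun do rewrite -mulN1r.
exact: measurable_expRM.
Qed.

Lemma continuous_Gamma_integrand (c t : R) : 0 < t ->
  {for t, continuous (Gamma_integrand c)}.
Proof.
move=> t0; apply: cvgM; first exact: continuous_powR.
by apply: continuous_comp; [exact: opp_continuous|exact: continuous_expR].
Qed.

Lemma Gamma_integrand_cvg_at_right0 (c : R) : 0 <= c ->
  Gamma_integrand c t @[t --> 0^'+] --> Gamma_integrand c 0.
Proof.
move=> c0; apply: cvgM; first exact: powR_cvg_at_right0.
apply: cvg_at_right_filter.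
by apply: continuous_comp; [exact: opp_continuous|exact: continuous_expR].
Qed.

Lemma Gamma_integral_fin c : 0 <= c -> I c \is a fin_num.
Proof.
move=> c0; have [C C0 HC] := powR_le_expR c0.
rewrite ge0_fin_numE; last first.
  by apply: integral_ge0 => t _; rewrite lee_fin mulr_ge0 ?powR_ge0 ?expR_ge0.
apply: (@le_lt_trans _ _
  (\int[mu]_(t in `]0%R, +oo[) (C%:E * (expR (- 2^-1 * t))%:E))%E).
  apply: ge0_le_integral => //=.
  - by move=> t _; rewrite lee_fin mulr_ge0 ?powR_ge0 ?expR_ge0.
  - by apply/measurable_EFinP; exact: measurable_Gamma_integrand.
  - by apply: measurable_funeM; apply/measurable_EFinP; exact: measurable_expRM.
  - by move=> t; rewrite in_itv/= andbT => t0; rewrite -EFinM lee_fin HC.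
rewrite ge0_integralZl_EFin//; last first.
  by apply/measurable_EFinP; exact: measurable_expRM.
by rewrite integral_expRM// -EFinM ltry.
Qed.

(** On (0, 1] the integrand is at least t^c / e, whose integral is 1 / (e (c + 1)). *)
Lemma Gamma_integral_gt0 c : 0 <= c -> (0 < I c)%E.
Proof.
move=> c0.
have e0 : 0 < expR (-1) / (c + 1) :> R by rewrite divr_gt0 ?expR_gt0// ltr_wpDl.
apply: (@lt_le_trans _ _ (expR (-1) / (c + 1))%:E); first by rewrite lte_fin.
apply: (@le_trans _ _ (\int[mu]_(t in `]0%R, 1%R]) (Gamma_integrand c t)%:E)%E);
  last first.
  apply: ge0_subset_integral => //=.
  - by apply/measurable_EFinP; exact: measurable_Gamma_integrand.
  - by move=> t _; rewrite lee_fin mulr_ge0 ?powR_ge0 ?expR_ge0.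
  - by move=> t /=; rewrite !in_itv/= => /andP[->].
have -> : (expR (-1) / (c + 1))%:E = (\int[mu]_(t in `]0%R, 1%R])
    ((expR (-1))%:E * (beta_fun 1 1 c 0 t)%:E))%E.
  rewrite ge0_integralZl_EFin ?expR_ge0//; last 2 first.
  - by move=> t _; rewrite lee_fin /beta_fun expr0 mulr1 powR_ge0.
  - by apply/measurable_EFinP; exact: measurable_beta_fun.
  rewrite beta_integral// /beta_val powR1 fact0 expr0 big_ord_recl big_ord0.
  by rewrite mul0r addr0 !mulr1 -EFinM mul1r.
apply: ge0_le_integral => //=.
- by move=> t _; rewrite lee_fin mulr_ge0 ?expR_ge0// /beta_fun expr0 mulr1 powR_ge0.
- by apply: measurable_funeM; apply/measurable_EFinP; exact: measurable_beta_fun.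
- by apply/measurable_EFinP; exact: measurable_Gamma_integrand.
move=> t; rewrite in_itv/= => /andP[t0 t1]; rewrite lee_fin.
by rewrite /beta_fun expr0 mulr1 mulrC ler_wpM2l ?powR_ge0// ler_expR lerN2.
Qed.

                                                                           
                                      
(** Integration by parts, but the derivative of t^(c+1) e^(-t) changes sign and the fundamental
    theorem on the half-line is applied to nonnegative integrands. Adding [E], a multiple of
    exp(-t/2) that dominates t^(c+1) e^(-t), gives the nonnegative [h] with primitive [F]. Both [h]
    and [E] have integral 2 C, so the correction cancels. *)
Lemma Gamma_integralS c : 0 <= c -> (I (c + 1) = (c + 1)%:E * I c)%E.
Proof.
move=> c0; have c1 : 0 < c + 1 by rewrite ltr_wpDl.
have [C C0 HC] := powR_le_expR (ltW c1).
pose E (t : R) := C * expR (- 2^-1 * t).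
pose h (t : R) := (c + 1) * Gamma_integrand c t - Gamma_integrand (c + 1) t + E t.
pose F (t : R) := t `^ (c + 1) * expR (-1 * t) - 2 * E t.
have G0 d (t : R) : 0 <= Gamma_integrand d t.
  by rewrite mulr_ge0 ?powR_ge0 ?expR_ge0.
have E0 (t : R) : 0 <= E t by rewrite mulr_ge0 ?expR_ge0.
have h0 (t : R) : 0 < t -> 0 <= h t.
  move=> t0; rewrite /h -addrA addr_ge0 ?(mulr_ge0 (ltW c1))//.
  by rewrite addrC subr_ge0 HC.
have mE : measurable_fun setT E.
  by apply: measurable_funM => //; exact: measurable_expRM.
have mh : measurable_fun setT h.
  apply: measurable_funD => //; apply: measurable_funB.
    by apply: measurable_funM => //; exact: measurable_Gamma_integrand.
  exact: measurable_Gamma_integrand.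
have intE : (\int[mu]_(t in `]0%R, +oo[) (E t)%:E = (2 * C)%:E)%E.
  under eq_integral do rewrite EFinM.
  rewrite ge0_integralZl_EFin//; last first.
    by apply/measurable_EFinP; exact: measurable_expRM.
  by rewrite integral_expRM// invrK -EFinM mulrC.
have inth : (\int[mu]_(t in `]0%R, +oo[) (h t)%:E = (2 * C)%:E)%E.
  have dE (t : R) : is_derive t 1 E (- 2^-1 * E t).
    have h1 := is_deriveZ C (is_derive_expRM (- 2^-1) t).
    by apply: (is_derive_eq h1); rewrite -![_ *: _]/(_ * _) /E; ring.
  have dF (t : R) : 0 < t -> is_derive t 1 F (h t).
    move=> t0.
    have h1 := is_deriveB (is_deriveM (is_derive1_powR (c + 1) t0)
      (is_derive_expRM (-1) t)) (is_deriveZ 2 (dE t)).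
    apply: (is_derive_eq h1).
    rewrite addrK /h /Gamma_integrand -![_ *: _]/(_ * _) !mulN1r /E.
    by field.
  have ch (T : set_system R) (t : R) : Filter T ->
      (forall d, 0 <= d -> Gamma_integrand d x @[x --> T] --> Gamma_integrand d t) ->
      E x @[x --> T] --> E t -> h x @[x --> T] --> h t.
    move=> FT GT ET; apply: cvgD => //; apply: cvgB; last exact: GT (ltW c1).
    by apply: cvgM; [exact: cvg_cst|exact: GT].
  have cE : continuous E.
    by move=> t; apply: cvgM; [exact: cvg_cst|exact: continuous_expRM].
  rewrite integral_itv_obnd_cbnd; last first.
    by apply/measurable_EFinP; exact: measurable_funTS.
  rewrite (@ge0_continuous_FTC2y _ h F 0 0).
  - have -> : F 0 = - (2 * C).
      by rewrite /F /E powR0 ?gt_eqF// !mulr0 expR0 !mulr1 sub0r.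
    by rewrite sub0e -EFinN opprK.
  - move=> t; rewrite le_eqVlt => /predU1P[<-|/h0//].
    rewrite /h {2}/Gamma_integrand powR0 ?gt_eqF// mul0r subr0.
    by rewrite addr_ge0 ?(mulr_ge0 (ltW c1)).
  - apply/continuous_within_itvcyP; split => [t|].
      rewrite in_itv/= andbT => t0; apply: ch => [d d0|]; last exact: cE.
      exact: continuous_Gamma_integrand.
    apply: ch => [d d0|]; first exact: Gamma_integrand_cvg_at_right0.
    exact/cvg_at_right_filter/cE.
  - have Ey : E t @[t --> +oo] --> 0.
      by rewrite -(mulr0 C); apply: cvgM; [exact: cvg_cst|exact: cvgy_expRM].
    rewrite -(subr0 0) -[X in _ - X](mulr0 2); apply: cvgB; last first.
      by apply: cvgM; first exact: cvg_cst.
    apply: (squeeze_cvgr _ (cvg_cst 0) Ey); near=> t.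
    have t0 : 0 < t by near: t; exact: nbhs_pinfty_gt.
    by rewrite mulN1r mulr_ge0 ?powR_ge0 ?expR_ge0//= HC.
  - by move=> t t0; have [] := dF t t0.
  - apply: cvgB.
      apply: cvgM; first exact/powR_cvg_at_right0/ltW.
      exact/cvg_at_right_filter/continuous_expRM.
    apply: cvgM; first exact: cvg_cst.
    exact/cvg_at_right_filter/cE.
  - move=> t; rewrite in_itv/= andbT => t0.
    by rewrite derive1E; have [_ ->] := dF t t0.
have : (\int[mu]_(t in `]0%R, +oo[) ((h t)%:E + (Gamma_integrand (c + 1) t)%:E) =
  \int[mu]_(t in `]0%R, +oo[)
    ((c + 1)%:E * (Gamma_integrand c t)%:E + (E t)%:E))%E.
  by apply: eq_integral => t _; rewrite -!EFinD; congr EFin; rewrite /h; ring.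
rewrite ge0_integralD//=; last 4 first.
- by move=> t; rewrite in_itv/= andbT => t0; rewrite lee_fin h0.
- by apply/measurable_EFinP; exact: measurable_funTS.
- by move=> t _; rewrite lee_fin.
- by apply/measurable_EFinP; exact: measurable_Gamma_integrand.
rewrite ge0_integralD//=; last 4 first.
- by move=> t _; rewrite -EFinM lee_fin mulr_ge0// ltW.
- apply: measurable_funeM; apply/measurable_EFinP.
  exact: measurable_Gamma_integrand.
- by move=> t _; rewrite lee_fin.
- by apply/measurable_EFinP; exact: measurable_funTS.
rewrite ge0_integralZl_EFin//=; last 3 first.
- by move=> t _; rewrite lee_fin.
- by apply/measurable_EFinP; exact: measurable_Gamma_integrand.
- exact: ltW.
rewrite inth intE addeC => /(congr1 (fun x => x - (2 * C)%:E)%E).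
by rewrite !addeK.
Unshelve. all: by end_near. Qed.

Lemma Gamma_gt0 (x : R) : 1 <= x -> 0 < Gamma x.
Proof.
move=> x1; rewrite fine_gt0//; have x0 : 0 <= x - 1 by rewrite subr_ge0.
rewrite (Gamma_integral_gt0 x0) -ge0_fin_numE ?Gamma_integral_fin//.
by rewrite ltW ?Gamma_integral_gt0.
Qed.

Lemma GammaS (x : R) : 1 <= x -> Gamma (x + 1) = x * Gamma x.
Proof.
move=> x1; have x0 : 0 <= x - 1 by rewrite subr_ge0.
have := Gamma_integralS x0; rewrite subrK => e.
rewrite /Gamma /Rintegral addrK -[in LHS]/(Gamma_integrand x) e.
by rewrite fineM ?Gamma_integral_fin.
Qed.

Lemma Gamma1 : Gamma (1 : R) = 1.
Proof.
rewrite /Gamma /Rintegral subrr -[RHS]invr1 -[RHS]/(fine 1^-1%:E); congr fine.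
rewrite -integral_expRM//; apply: eq_integral => t _.
by rewrite powRr0 mul1r mulN1r.
Qed.

Lemma Gamma_add (x : R) (n : nat) : 1 <= x ->
  Gamma (x + n%:R) = (\prod_(i < n) (x + i%:R)) * Gamma x.
Proof.
move=> x1; elim: n => [|n IH]; first by rewrite big_ord0 addr0 mul1r.
rewrite big_ord_recr/= -natr1 addrA GammaS ?IH; first by ring.
by rewrite (le_trans x1)// lerDl.
Qed.

Lemma Gamma_nat (n : nat) : Gamma (n%:R + 1 : R) = n`!%:R.
Proof.
rewrite addrC Gamma_add// Gamma1 mulr1.
elim: n => [|n IH]; first by rewrite big_ord0.
by rewrite big_ord_recr/= IH factS natrM mulrC nat1r.
Qed.

(** The recurrence takes Gamma(q + 1 + n) down to Gamma(q + 1), which cancels. *)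
Lemma rbinom_nat (n : nat) (q : R) : 0 <= q ->
  rbinom (n%:R + q) n%:R = \prod_(i < n) (q + 1 + i%:R) / n`!%:R.
Proof.
move=> q0; rewrite /rbinom Gamma_nat.
have -> : n%:R + q + 1 = q + 1 + n%:R by ring.
have -> : n%:R + q - n%:R + 1 = q + 1 by ring.
have q1 : 1 <= q + 1 by rewrite lerDr.
rewrite Gamma_add//; field.
by rewrite pnatr_eq0 -lt0n fact_gt0 gt_eqF ?Gamma_gt0.
Qed.

End GammaFunction.

                                               

(** * Comparison of the level counts with the extremal profile *)

Section SingleCrossing.
Context {R : realType}.
Notation mu := (@lebesgue_measure R).

Lemma integral_powR (c u : R) : 0 <= c -> 0 <= u ->
  (\int[mu]_(t in `]0%R, u]) (t `^ c)%:E = (u `^ (c + 1) / (c + 1))%:E)%E.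
Proof.
move=> c0; rewrite le_eqVlt => /predU1P[<-|u0].
  rewrite set_itvoc0 integral_set0 powR0 ?mul0r//.
  by rewrite gt_eqF// ltr_wpDl.
have := @beta_integral R 1 u c 0 ltr01 u0 c0.
rewrite /beta_val fact0 expr0 big_ord_recl big_ord0 mul0r addr0 !mulr1 => <-.
by apply: eq_integral => t _; rewrite /beta_fun expr0 mulr1.
Qed.

Variables (T : finType) (D : pred T) (phi psi : T -> R) (n : nat).
Variables (m r F b : R).
Hypotheses (m0 : 0 < m) (r1 : 1 < r) (F0 : 0 < F) (b0 : 0 < b).
Hypothesis phi_itv : forall x, D x -> 0 <= phi x <= F.
Hypothesis psi_ge0 : forall x, 0 <= psi x.
Hypothesis phi_psi : forall x, D x -> phi x <= psi x.

Let N (t : R) : R := #|[pred x | D x & t <= phi x]|%:R.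
Let Nd (t : R) : R := #|[pred x | t <= psi x]|%:R.
Let M : R := #|D|%:R.

(** The only trace of convexity in this section. It is supplied by Brunn-Minkowski for the whole
    domain and the level set at [s], with m = 1/p. *)
Hypothesis level_concave : forall t s, 0 < t -> t < s -> s <= F ->
  ((1 - (t / s) `^ m) * M `^ n.+1%:R^-1 + (t / s) `^ m * N s `^ n.+1%:R^-1) ^+ n.+1
    <= Nd t.

(** For c = 0 this is the extremal profile: on (0, b] its root of order n + 1 is affine in t^m. For
    other [c] it is the same profile weighted by t^c. *)
Let g (c t : R) : R := if t <= b then M * beta_fun m b c n.+1 t else 0.

Let N_le_Nd t : N t <= Nd t.
Proof.
rewrite ler_nat; apply/subset_leq_card/fintype.subsetP => x; rewrite !inE.
by move=> /andP[Dx /le_trans]; apply; exact: phi_psi.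
Qed.

Let powRV (x : R) : 0 <= x -> x = (x `^ n.+1%:R^-1) ^+ n.+1.
Proof.
by move=> x0; rewrite -powR_mulrn ?powR_ge0// -powRrM mulVf ?pnatr_eq0// powRr1.
Qed.

Let onem_ge0 t : 0 < t -> t <= b -> 0 <= 1 - t `^ m / b `^ m.
Proof.
move=> t0 tb; rewrite subr_ge0 ler_pdivrMr ?powR_gt0// mul1r.
by apply: ge0_ler_powR; rewrite ?nnegrE ?(ltW m0) ?(ltW t0) ?(ltW b0).
Qed.

Let g_ge0 c t : 0 < t -> 0 <= g c t.
Proof.
move=> t0; rewrite /g; case: ifP => // tb.
by rewrite mulr_ge0 ?ler0n// mulr_ge0 ?powR_ge0// exprn_ge0 ?onem_ge0.
Qed.

Let mulr_g c t : t `^ c * g 0 t = g c t.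
Proof.
rewrite /g; case: ifP => _; rewrite ?mulr0//.
by rewrite /beta_fun powRr0 mul1r mulrCA.
Qed.

Let N_gt t : F < t -> N t = 0.
Proof.
move=> Ft; rewrite /N eq_card0// => x; rewrite !inE; apply/negbTE.
rewrite negb_and -ltNge -implybE.
by apply/implyP => /phi_itv /andP[_ /le_lt_trans]; exact.
Qed.

(** The profile is the equality case of [level_concave]: with l = (t/s)^m, (1 - l) + l (1 - (s/b)^m)
    = 1 - (t/b)^m. If s > b, the value 1 - (s/b)^m is negative and the needed lower bound on N(s) is
    trivial. *)
Let g_le_Nd t s : 0 < t -> t < s -> s <= F -> g 0 s <= N s -> g 0 t <= Nd t.
Proof.
move=> t0 ts sF gN; rewrite /g; case: ifP => tb; last exact: ler0n.
have s0 : 0 < s by exact: lt_trans ts.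
have bm : 0 < b `^ m by rewrite powR_gt0.
have sm : 0 < s `^ m by rewrite powR_gt0.
set L := M `^ n.+1%:R^-1.
have L0 : 0 <= L by exact: powR_ge0.
have NL : L * (1 - s `^ m / b `^ m) <= N s `^ n.+1%:R^-1.
  case: (leP s b) => sb; last first.
    apply: le_trans (powR_ge0 _ _); rewrite mulr_ge0_le0// subr_le0.
    rewrite ler_pdivlMr// mul1r.
    by apply: ge0_ler_powR;
      rewrite ?nnegrE ?(ltW m0) ?(ltW s0) ?(ltW b0) ?(ltW sb).
  rewrite -(ler_pXn2r (ltn0Sn n)) ?nnegrE ?powR_ge0 ?mulr_ge0 ?onem_ge0//.
  rewrite -powRV ?ler0n// exprMn -powRV ?ler0n//.
  by move: gN; rewrite /g sb /beta_fun powRr0 mul1r.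
apply: le_trans (level_concave t0 ts sF).
rewrite /beta_fun powRr0 mul1r {1}(@powRV M) ?ler0n// -exprMn -/L.
have ts1 : (t / s) `^ m <= 1.
  have -> : 1 = 1 `^ m by rewrite powR1.
  apply: ge0_ler_powR;
    rewrite ?nnegrE ?divr_ge0 ?(ltW t0) ?(ltW s0) ?(ltW m0)//.
  by rewrite ler_pdivrMr// mul1r ltW.
rewrite ler_pXn2r ?nnegrE//; first last.
- by rewrite addr_ge0// mulr_ge0 ?powR_ge0// subr_ge0.
- by rewrite mulr_ge0// onem_ge0.
apply: le_trans (lerD (lexx _) (ler_wpM2l (powR_ge0 _ _) NL)).
have -> : (t / s) `^ m = t `^ m / s `^ m.
  rewrite powRM ?invr_ge0 ?(ltW t0) ?(ltW s0)//; congr (_ * _).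
  apply: (mulIf (lt0r_neq0 sm)).
  by rewrite mulVf ?gt_eqF// -powRM ?invr_ge0 ?(ltW s0)// mulVf ?gt_eqF// powR1.
rewrite le_eqVlt; apply/orP; left; apply/eqP.
by field; rewrite !gt_eqF.
Qed.

(** Equivalently w (Nt - gt) <= k (Ndt - gt). The subtraction-free form is the one integrated later,
    as a comparison of nonnegative functions. The three cases are levels below, above and at the
    crossing. *)
Let pointwise (k w Nt Ndt gt : R) : 0 <= k -> 0 <= w -> Nt <= Ndt ->
  (w <= k /\ gt <= Ndt) \/ (k <= w /\ Nt <= gt) \/ w = k ->
  k * gt + w * Nt <= k * Ndt + w * gt.
Proof.
move=> k0 w0 NN H.
suff : w * (Nt - gt) <= k * (Ndt - gt) by rewrite !mulrBr; lra.
have kk : k * (Nt - gt) <= k * (Ndt - gt) by rewrite ler_wpM2l// lerB.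
case: H => [[wk gN]|[[kw Ng]|->//]].
  case: (leP Nt gt) => [Ng|/ltW gN'].
    apply: (@le_trans _ _ 0); first by rewrite mulr_ge0_le0// subr_le0.
    by rewrite mulr_ge0// subr_ge0.
  by apply: le_trans kk; rewrite ler_wpM2r// subr_ge0.
by apply: le_trans kk; rewrite ler_wnM2r// subr_le0.
Qed.

(** A common bound for [F], [b] and all values of [psi], so that every integral runs over the same
    interval. *)
Let C : R := F + b + \sum_x psi x.

Let psi_le x : psi x <= C.
Proof.
rewrite /C (bigD1 x)//= addrCA lerDl addr_ge0 ?sumr_ge0//.
by rewrite addr_ge0// ltW.
Qed.

Let bC : b <= C.
Proof. by rewrite /C addrAC lerDr addr_ge0 ?sumr_ge0// ltW. Qed.

Let FC : F <= C.
Proof. by rewrite /C -addrA lerDl addr_ge0 ?sumr_ge0// ltW. Qed.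

Let measurable_g c (S : set R) : measurable_fun S (g c).
Proof.
apply: measurable_funTS; apply: measurable_fun_ifT => //.
  exact: measurable_fun_ler.
by apply: measurable_funM => //; exact: measurable_beta_fun.
Qed.

Let int_g c : 0 <= c ->
  (\int[mu]_(t in `]0%R, C]) (g c t)%:E = (M * beta_val m b c n.+1)%:E)%E.
Proof.
move=> c0; rewrite EFinM -beta_integral// -ge0_integralZl_EFin//; last 2 first.
- move=> t /=; rewrite in_itv/= => /andP[t0 tb]; rewrite lee_fin.
  by rewrite mulr_ge0 ?powR_ge0// exprn_ge0 ?onem_ge0.
- by apply/measurable_EFinP; exact: measurable_beta_fun.
rewrite (_ : `]0, b]%classic = `]0, C]%classic `&` `]-oo, b]%classic);
  last first.
  apply/seteqP; split => t /=; rewrite !in_itv/= ?andbT.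
    by move=> /andP[-> tb]; rewrite tb (le_trans tb).
  by move=> [/andP[-> _] ->].
rewrite integral_mkcondr; apply: eq_integral => t _.
by rewrite /patch mem_setE in_itv/= /g; case: ifP.
Qed.

Let int_N : (\int[mu]_(t in `]0%R, C]) (t `^ (r - 1) * N t)%:E
  = ((\sum_(x | D x) phi x `^ r) / r)%:E)%E.
Proof.
have r0 : 0 <= r - 1 by rewrite subr_ge0 ltW.
rewrite integral_layers//; last 2 first.
- by move=> t; exact: powR_ge0.
- by move=> x /phi_itv /andP[_ /le_trans]; apply.
rewrite mulr_suml -sumEFin; apply: eq_bigr => x Dx.
have /andP[p0 _] := phi_itv Dx.
by rewrite integral_powR// subrK.
Qed.

Let int_Nd : (\int[mu]_(t in `]0%R, C]) (Nd t)%:E = (\sum_x psi x)%:E)%E.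
Proof.
have := @integral_layers R T xpredT psi C (fun=> 1) (measurable_cst _) (fun=> ler01)
  (fun x _ => psi_le x).
under eq_integral do rewrite mul1r.
move=> ->; rewrite -sumEFin; apply: eq_bigr => x _.
have := @integral_powR 0 (psi x) (lexx _) (psi_ge0 x).
rewrite add0r powRr1// divr1 => <-.
by apply: eq_integral => t _; rewrite powRr0.
Qed.

Let measurable_N (S : set R) : measurable_fun S N.
Proof. exact: measurable_layers. Qed.

Let measurable_Nd (S : set R) : measurable_fun S Nd.
Proof. exact: (@measurable_layers R T xpredT psi S). Qed.

Let measurable_WN (S : set R) : measurable_fun S (fun t => t `^ (r - 1) * N t).
Proof.
apply: measurable_funM => //; apply: measurable_funTS; exact: measurable_powR.
Qed.

Lemma single_crossing :
  M * beta_val m b (r - 1) n.+1 < (\sum_(x | D x) phi x `^ r) / r ->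
  M * beta_val m b 0 n.+1 <= \sum_x psi x.
Proof.
move=> ltq; have r0 : 0 <= r - 1 by rewrite subr_ge0 ltW.
pose E := [set s : R | [/\ 0 < s, s <= F & g 0 s <= N s]].
(* If N stayed below the profile at every level, the weighted integrals would contradict the strict
   hypothesis. *)
have [s Es] : E !=set0.
  apply: contrapT => /nonemptyPn E0.
  have Ng (t : R) : 0 < t -> N t <= g 0 t.
    move=> t0; case: (leP t F) => [tF|/N_gt ->]; last exact: g_ge0.
    rewrite leNgt; apply/negP => /ltW gN.
    by have : E t by []; rewrite E0.
  move: ltq; apply/negP; rewrite -leNgt -lee_fin -int_N -int_g//.
  apply: ge0_le_integral => //=.
  - by move=> t _; rewrite lee_fin mulr_ge0 ?powR_ge0 ?ler0n.
  - by apply/measurable_EFinP; exact: measurable_WN.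
  - by apply/measurable_EFinP; exact: measurable_g.
  move=> t; rewrite in_itv/= => /andP[t0 _]; rewrite lee_fin -(mulr_g (r - 1)).
  by rewrite ler_wpM2l ?powR_ge0 ?Ng.
have supE : has_sup E by split; [exists s|exists F => ? []].
set t0 := sup E.
have st0 : s <= t0 by apply: sup_upper_bound.
have t0_gt0 : 0 < t0 by apply: lt_le_trans st0; case: Es.
set k := t0 `^ (r - 1).
have k0 : 0 < k by rewrite powR_gt0.
have key (t : R) : 0 < t ->
    k * g 0 t + t `^ (r - 1) * N t <= k * Nd t + t `^ (r - 1) * g 0 t.
  move=> tp; apply: pointwise; rewrite ?powR_ge0 ?N_le_Nd//.
  (* Below [t0] some element of [E] lies further right, so g <= Nd by propagation. Above [t0] no
     level is in [E], so N <= g. At [t0] neither comparison is available, but the two weights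
     coincide and N <= Nd suffices. *)
  have [tt0|t0t|->] := ltgtP t t0; last by right; right.
  - left; split.
      by apply: ge0_ler_powR; rewrite ?nnegrE ?(ltW tp) ?(ltW t0_gt0) ?(ltW tt0).
    have [u [u0 uF gNu] tu] := sup_gt (ex_intro _ s Es) tt0.
    exact: g_le_Nd tp tu uF gNu.
  - right; left; split.
      by apply: ge0_ler_powR; rewrite ?nnegrE ?(ltW tp) ?(ltW t0_gt0) ?(ltW t0t).
    case: (leP t F) => [tF|/N_gt ->]; last exact: g_ge0.
    rewrite leNgt; apply/negP => /ltW gN.
    have : t <= t0 by apply: sup_upper_bound.
    by rewrite leNgt t0t.
have : (\int[mu]_(t in `]0%R, C]) (k%:E * (g 0 t)%:E + (t `^ (r - 1) * N t)%:E)
    <= \int[mu]_(t in `]0%R, C]) (k%:E * (Nd t)%:E + (g (r - 1) t)%:E))%E.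
  apply: ge0_le_integral => //=.
  - move=> t; rewrite in_itv/= => /andP[tp _]; rewrite -EFinM -EFinD lee_fin.
    by rewrite addr_ge0// mulr_ge0 ?powR_ge0 ?ler0n ?g_ge0// ltW.
  - by apply: emeasurable_funD; [apply: measurable_funeM|]; apply/measurable_EFinP;
      [exact: measurable_g|exact: measurable_WN].
  - by apply: emeasurable_funD; [apply: measurable_funeM|]; apply/measurable_EFinP;
      [exact: measurable_Nd|exact: measurable_g].
  - move=> t; rewrite in_itv/= => /andP[tp _]; rewrite -!EFinM -!EFinD lee_fin.
    by rewrite -(mulr_g (r - 1)); exact: key.
have mgE c : measurable_fun `]0, C] (fun t => (g c t)%:E).
  by apply/measurable_EFinP; exact: measurable_g.
have mNdE : measurable_fun `]0, C] (fun t => (Nd t)%:E).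
  by apply/measurable_EFinP; exact: measurable_Nd.
have mWNE : measurable_fun `]0, C] (fun t => (t `^ (r - 1) * N t)%:E).
  by apply/measurable_EFinP; exact: measurable_WN.
have gE0 c (t : R) : `]0, C]%classic t -> (0 <= (g c t)%:E)%E.
  by rewrite /= in_itv/= => /andP[tp _]; rewrite lee_fin g_ge0.
rewrite ge0_integralD//=; last 3 first.
- by move=> t /gE0 ?; rewrite mule_ge0// lee_fin ltW.
- by apply: measurable_funeM; exact: mgE.
- by move=> t _; rewrite lee_fin mulr_ge0 ?powR_ge0 ?ler0n.
rewrite ge0_integralD//=; last 4 first.
- by move=> t _; rewrite mule_ge0// lee_fin ?ler0n// ltW.
- exact: measurable_funeM.
- by move=> t /gE0.
- exact: mgE.
rewrite !ge0_integralZl_EFin//=; do ? by [exact: ltW | move=> t /gE0 | exact: mgE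
  | move=> t _; rewrite lee_fin ler0n].
rewrite int_N int_Nd !int_g// -!EFinM -!EFinD lee_fin => H.
have : k * (M * beta_val m b 0 n.+1) <= k * (\sum_x psi x) by lra.
by rewrite ler_pM2l.
Qed.

End SingleCrossing.

(** For m = 1/p, the choices s = p and s = q give the two integrals of the profile; this is where
    the binomial coefficients of the theorem come from. *)
Lemma beta_val_rbinom (R : realType) (m b s : R) (n : nat) : 0 < m -> 0 < s ->
  beta_val m b (m * s - 1) n = b `^ (m * s) / (m * s * rbinom (n%:R + s) n%:R).
Proof.
move=> m0 s0; rewrite /beta_val rbinom_nat ?ltW// subrK.
have -> : \prod_(i < n.+1) (m * s + i%:R * m)
    = m * s * (m ^+ n * \prod_(i < n) (s + 1 + i%:R)).
  rewrite big_ord_recl mul0r addr0; congr (_ * _).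
  rewrite -[X in m ^+ X](card_ord n) -prodr_const -big_split.
  by apply: eq_bigr => i _; rewrite lift0 -natr1 /=; ring.
have P0 : \prod_(i < n) (s + 1 + i%:R) != 0.
  rewrite gt_eqF// prodr_gt0// => i _.
  by apply: ltr_wpDr; [exact: ler0n|exact: addr_gt0].
have mn0 : m ^+ n != 0 by rewrite expf_neq0// gt_eqF.
have fn0 : n`!%:R != 0 :> R by rewrite pnatr_eq0 -lt0n fact_gt0.
set P := \prod_(i < n) _ in P0 *.
by field; rewrite P0 mn0 fn0 !gt_eqF.
Qed.

(** Otherwise B < A^(p/q), and the midpoint [b] of the two satisfies b^(q/p) < A but exceeds [B]. *)
Lemma powR_le_of_dominated (R : realType) (p q A B : R) :
  0 < p -> p < q -> 0 <= A -> 0 <= B ->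
  (forall b, 0 < b -> b `^ (q / p) < A -> b <= B) -> A `^ q^-1 <= B `^ p^-1.
Proof.
move=> p0 pq A0 B0 H; have q0 : 0 < q by exact: lt_trans pq.
rewrite leNgt; apply/negP => lt.
have BA : B < A `^ (p / q).
  have := @gt0_ltr_powR _ p p0 _ _ (powR_ge0 _ _) (powR_ge0 _ _) lt.
  by rewrite -!powRrM mulVf ?gt_eqF// powRr1// (mulrC q^-1).
pose b := (B + A `^ (p / q)) / 2.
have [Bb bA] : B < b /\ b < A `^ (p / q) by rewrite /b; split; lra.
have b0 : 0 < b by exact: le_lt_trans Bb.
suff : b <= B by rewrite leNgt Bb.
apply: H => //.
have qp : 0 < q / p by rewrite divr_gt0.
have := @gt0_ltr_powR _ (q / p) qp _ _ (ltW b0) (powR_ge0 _ _) bA.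
rewrite -powRrM (_ : p / q * (q / p) = 1) ?powRr1//.
by field; rewrite !gt_eqF.
Qed.

                                       

(** * Lattice points of a bounded set, indexed by a finite box *)

Section LatticeBox.
Context {R : realType} {n : nat}.
Variable m : nat.

(** Coordinates 0, ..., 2m are shifted to -m, ..., m, so that the combinatorial results about tuples
    of ordinals apply. *)
Definition box_point (t : n.-tuple 'I_(m.*2.+1)) : 'rV[R]_n :=
  \row_i ((tnth t i)%:R - m%:R).

Lemma box_point_inj : injective box_point.
Proof.
move=> s t /rowP e; apply: eq_from_tnth => i; apply: val_inj.
have := e i; rewrite !mxE => /addIr /eqP.
by rewrite eqr_nat => /eqP.
Qed.

Lemma box_point_lattice t : int_lattice R n (box_point t).
Proof. by move=> i; rewrite mxE rpredB ?natr_int. Qed.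

Lemma box_point_surj x : int_lattice R n x -> (forall i, `|x 0 i| <= m%:R) ->
  exists t, box_point t = x.
Proof.
move=> xZ xm.
have H i : exists j : 'I_(m.*2.+1), j%:R - m%:R = x 0 i.
  have /intrP[z xz] := xZ i.
  have := xm i; rewrite xz ler_norml => /andP[h1 h2].
  have zm : (0 <= z + m%:Z)%R.
    rewrite -(ler_int R) intrD; move: h1; rewrite -pmulrn; lra.
  have zm2 : (absz (z + m%:Z)%R < m.*2.+1)%N.
    rewrite ltnS -(ler_nat R) natr_absz ger0_norm// intrD -addnn natrD -pmulrn.
    lra.
  exists (Ordinal zm2) => /=.
  by rewrite natr_absz ger0_norm// intrD -pmulrn addrK.
exists [tuple projT1 (cid (H i)) | i < n].
by apply/rowP => i; rewrite mxE tnth_mktuple; case: cid.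
Qed.

Lemma lattice_box_image (S : set 'rV[R]_n) :
  (forall x i, S x -> `|x 0 i| <= m%:R) ->
  S `&` int_lattice R n = box_point @` [set t | `[< S (box_point t) >]].
Proof.
move=> Sm; apply/seteqP; split => [x [Sx xZ]|_ [t /asboolP St <-]].
  have [t tx] := box_point_surj xZ (fun i => Sm x i Sx).
  by exists t => //; apply/asboolP; rewrite tx.
by split => //; exact: box_point_lattice.
Qed.

Lemma sum_lattice_box (V : Type) (idx : V) (op : Monoid.com_law idx)
    (S : set 'rV[R]_n) (G : 'rV[R]_n -> V) :
  (forall x i, S x -> `|x 0 i| <= m%:R) ->
  \big[op/idx]_(x \in S `&` int_lattice R n) G x
    = \big[op/idx]_(t | `[< S (box_point t) >]) G (box_point t).
Proof.
move=> Sm; rewrite lattice_box_image// fsbig_image; last first.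
  by move=> s t _ _; exact: box_point_inj.
by rewrite fsbig_finType.
Qed.

Lemma Gn_box (S : set 'rV[R]_n) : (forall x i, S x -> `|x 0 i| <= m%:R) ->
  Gn S = #|[pred t | `[< S (box_point t) >]]|.
Proof.
move=> Sm; rewrite /Gn card_fset_sum1 -sum1_card.
have := @sum_lattice_box nat 0%N addn S (fun=> 1%N) Sm.
rewrite fsbig_finite; last first.
  by rewrite lattice_box_image//; apply: finite_image; exact: finite_finset.
by move=> ->; apply: eq_bigl => t; rewrite inE.
Qed.

End LatticeBox.

(** The extra 1 leaves room for the open cube, so that one box contains both [K] and its Minkowski
    sum with the cube. *)
Lemma bounded_coord (R : realType) (n : nat) (K : set 'rV[R]_n) : bounded_set K ->
  exists m : nat, forall x i, K x -> `|x 0 i| + 1 <= m%:R.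
Proof.
move=> [M [Mreal KM]].
have M1 : M < `|M| + 1 by rewrite ltr_pwDr// real_ler_norm.
exists (Num.truncn (`|M| + 1 + 1)).+1 => x i Kx.
have xi : `|x 0 i| <= `|M| + 1.
  apply: le_trans (KM _ M1 x Kx); rewrite [leRHS]mx_normrE.
  exact: (le_bigmax _ _ (0, i)).
by apply: ltW; apply: le_lt_trans (truncnS_gt _); rewrite lerD2r.
Qed.

(** * Bounds on the diamond of a function, and concavity along segments *)

Section Diamond.
Context {R : realType} {n : nat}.
Variables (K : set 'rV[R]_n) (f : 'rV[R]_n -> R).
Hypotheses (K_convex : convex_set K) (K_0 : K 0).
Hypothesis f_ge0 : forall x, K x -> 0 <= f x.
Hypothesis f_concave : concave_function K f.
Hypothesis f_max0 : forall x, K x -> f x <= f 0.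

Lemma zero_ext_le x : zero_ext K f x <= f 0.
Proof.
rewrite /zero_ext /patch; case: ifPn => [|_]; last exact: f_ge0.
by rewrite inE; exact: f_max0.
Qed.

Lemma diamond_has_sup z : has_sup [set zero_ext K f (z + u) | u in open_cube R n].
Proof.
split; last by exists (f 0) => _ [u _ <-]; exact: zero_ext_le.
exists (zero_ext K f (z + 0)); exists 0 => // i.
by rewrite mxE ltr01 ltrN10.
Qed.

Lemma diamond_ge (w z : 'rV[R]_n) :
  K w -> (forall i, `|w 0 i - z 0 i| < 1) -> f w <= diamond K f z.
Proof.
move=> Kw wz; apply: sup_upper_bound; first exact: diamond_has_sup.
exists (w - z); first by move=> i; rewrite !mxE -ltr_norml.
by rewrite addrC subrK /zero_ext /patch mem_set.
Qed.

Lemma diamond_ge0 z : 0 <= diamond K f z.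
Proof.
apply: (@le_trans _ _ (zero_ext K f (z + 0))).
  by rewrite /zero_ext /patch; case: ifPn => // /set_mem; exact: f_ge0.
apply: sup_upper_bound; first exact: diamond_has_sup.
by exists 0 => // i; rewrite mxE ltr01 ltrN10.
Qed.

Lemma minkowski_sum_near (w z : 'rV[R]_n) :
  K w -> (forall i, `|w 0 i - z 0 i| < 1) ->
  minkowski_sum K (open_cube R n) z.
Proof.
move=> Kw wz; exists w => //; exists (z - w); last by rewrite addrC subrK.
by move=> i; rewrite !mxE -ltr_norml distrC.
Qed.

Lemma concave_comb (a b : R) x y : 0 <= a -> 0 <= b -> a + b = 1 -> K x -> K y ->
  K (a *: x + b *: y) /\ a * f x + b * f y <= f (a *: x + b *: y).
Proof.
move=> a0 b0 ab Kx Ky.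
have a1 : a <= 1 by rewrite -ab lerDl.
have be : b = 1 - a by rewrite -ab addrC addKr.
pose t : {i01 R} := Itv01 a0 a1.
have := K_convex t (mem_set Kx) (mem_set Ky).
have := f_concave t (mem_set Kx) (mem_set Ky).
by rewrite be => h /set_mem h'.
Qed.

End Diamond.

(** * The inequality when the maximum of [f] is positive *)

Section BerwaldLattice.
Context {R : realType} {k : nat}.
Let n := k.+1.
Variables (K : set 'rV[R]_n) (f : 'rV[R]_n -> R) (m : nat) (p q : R).
Hypotheses (K_convex : convex_set K) (K_0 : K 0).
Hypothesis f_ge0 : forall x, K x -> 0 <= f x.
Hypothesis f_concave : concave_function K f.
Hypothesis f_max0 : forall x, K x -> f x <= f 0.
Hypothesis Km : forall x i, K x -> `|x 0 i| + 1 <= m%:R.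
Hypotheses (p0 : 0 < p) (pq : p < q) (f0_gt0 : 0 < f 0).

Let B := m.*2.+1.
Let D : pred (n.-tuple 'I_B) := [pred t | `[< K (box_point t) >]].
Let phi (t : n.-tuple 'I_B) := f (box_point t) `^ p.
(** Extended by zero, so that the sum over the Minkowski sum becomes a sum over the whole box. *)
Let psi (t : n.-tuple 'I_B) :=
  if `[< minkowski_sum K (open_cube R n) (box_point t) >]
  then diamond K f (box_point t) `^ p else 0.

(** Since a + b = 1, the shift by [m] in [box_point] cancels. *)
Lemma near_box_point (a b : R) (x y z : n.-tuple 'I_B) : a + b = 1 ->
  (forall i, near_comb a b (tnth x i) (tnth y i) (tnth z i)) ->
  forall i, `|(a *: box_point x + b *: box_point y) 0 i - box_point z 0 i| < 1.
Proof.
move=> ab xyz i; move: (xyz i); rewrite /near_comb distrC !mxE.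
set u := _%:R; set v := _%:R; set w := _%:R => h.
rewrite (_ : _ - _ = a * u + b * v - w)//.
have -> : b = 1 - a by rewrite -ab addrC addKr.
by ring.
Qed.

Let origin_box : exists o : n.-tuple 'I_B, box_point o = 0 :> 'rV[R]_n.
Proof.
apply: box_point_surj => i; rewrite mxE; first exact: rpred0.
by rewrite normr0 ler0n.
Qed.

Let level_concave (t s : R) : 0 < t -> t < s -> s <= f 0 `^ p ->
  ((1 - (t / s) `^ p^-1) * #|D|%:R `^ n%:R^-1
    + (t / s) `^ p^-1 * #|[pred x | D x & s <= phi x]|%:R `^ n%:R^-1) ^+ n
  <= #|[pred x | t <= psi x]|%:R.
Proof.
move=> t0 ts sF; have s0 : 0 < s by exact: lt_trans ts.
set l := (t / s) `^ p^-1.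
have l0 : 0 < l by rewrite powR_gt0// divr_gt0.
have pV : 0 < p^-1 by rewrite invr_gt0.
have l1 : l < 1.
  have -> : 1 = 1 `^ p^-1 :> R by rewrite powR1.
  apply: gt0_ltr_powR; rewrite ?nnegrE ?divr_ge0 ?(ltW t0) ?(ltW s0)//.
  by rewrite ltr_pdivrMr// mul1r.
have ol0 : 0 < 1 - l by rewrite subr_gt0.
(* The origin is a lattice point of [K] at which [f] is maximal, so it lies in every level set with
   s <= f(0)^p; both sets fed to Brunn-Minkowski are therefore nonempty. *)
have [c cE] := origin_box.
have Dc : D c by apply/asboolP; rewrite cE.
have pc : s <= phi c by rewrite /phi cE.
apply: card_pow_sum_ge => //; rewrite ?subrK//.
- by apply/card_gt0P; exists c; exact: Dc.
- by rewrite (cardD1 c) !inE/= Dc pc.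
move=> x y z /asboolP Kx /andP[/asboolP Ky sy] xyz /=.
have [Kw fw] := concave_comb K_convex f_concave (ltW ol0) (ltW l0) (subrK _ _) Kx Ky.
have wz := near_box_point (subrK _ _) xyz.
rewrite /psi asboolT; last exact: minkowski_sum_near Kw wz.
have dw := diamond_ge K_0 f_ge0 f_max0 Kw wz.
(* It remains to show that the diamond at [z] is at least l s^(1/p). It is at least (1 - l) f(x) + l
   f(y) by concavity, the first term is nonnegative, and f(y) >= s^(1/p). *)
have tE : t = (l * s `^ p^-1) `^ p.
  rewrite -powRM ?divr_ge0 ?(ltW t0) ?(ltW s0)// divfK ?gt_eqF//.
  by rewrite -powRrM mulVf ?gt_eqF// powRr1// ltW.
rewrite [leLHS]tE; apply: ge0_ler_powR.
- exact: ltW.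
- by rewrite nnegrE mulr_ge0 ?powR_ge0.
- by rewrite nnegrE diamond_ge0.
apply: le_trans dw; apply: le_trans fw; apply: ler_wpDl.
  by rewrite mulr_ge0 ?f_ge0// ltW.
rewrite ler_wpM2l ?(ltW l0)//.
have := sy; rewrite /phi => sy'.
have fy0 := f_ge0 Ky.
rewrite -[leRHS](powRr1 fy0) -(mulfV (lt0r_neq0 p0)) powRrM.
by apply: ge0_ler_powR; rewrite ?nnegrE ?powR_ge0 ?(ltW pV) ?(ltW s0).
Qed.

Lemma berwald_lattice :
  (rbinom (n%:R + q) n%:R / (Gn K)%:R
     * \sum_(x \in K `&` int_lattice R n) f x `^ q) `^ q^-1
  <= (rbinom (n%:R + p) n%:R / (Gn K)%:R
        * \sum_(x \in minkowski_sum K (open_cube R n) `&` int_lattice R n)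
            diamond K f x `^ p) `^ p^-1.
Proof.
have Km' x i : K x -> `|x 0 i| <= m%:R.
  by move=> /(Km i); apply: le_trans; rewrite lerDl.
have KCm x i : minkowski_sum K (open_cube R n) x -> `|x 0 i| <= m%:R.
  move=> [y Ky [u uC <-]]; apply: le_trans (Km i Ky); rewrite mxE.
  apply: le_trans (ler_normD _ _) _; rewrite lerD2l ltW// ltr_norml.
  exact: uC.
rewrite (Gn_box Km') (sum_lattice_box _ _ Km') (sum_lattice_box _ _ KCm)/=.
rewrite [X in _ <= (_ * X) `^ _]big_mkcond/=.
have q0 : 0 < q by exact: lt_trans pq.
have rb (s : R) : 0 < s -> 0 < rbinom (n%:R + s) n%:R.
  move=> s0; rewrite rbinom_nat ?ltW// divr_gt0 ?ltr0n ?fact_gt0//.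
  by apply: prodr_gt0 => i _; rewrite ltr_wpDr ?ler0n// addr_gt0.
have M0 : 0 < #|D|%:R :> R.
  have [c cE] := origin_box.
  by rewrite ltr0n; apply/card_gt0P; exists c; apply/asboolP; rewrite cE.
rewrite -/D.
apply: powR_le_of_dominated => //.
- apply: mulr_ge0; first by apply: divr_ge0; [exact/ltW/rb|exact: ltW].
  by apply: sumr_ge0 => t _; exact: powR_ge0.
- apply: mulr_ge0; first by apply: divr_ge0; [exact/ltW/rb|exact: ltW].
  by apply: sumr_ge0 => t _; case: ifP => _; rewrite ?powR_ge0.
(* Here [b] is the parameter of the extremal profile, and [bq] says that its weighted integral is
   smaller than that of the level counts of f^p. *)
move=> b b0 bq.
have m0 : 0 < p^-1 by rewrite invr_gt0.
have r1 : 1 < q / p by rewrite ltr_pdivlMr// mul1r.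
have F0 : 0 < f 0 `^ p by rewrite powR_gt0.
have := @single_crossing R _ D phi psi k p^-1 (q / p) (f 0 `^ p) b m0 r1 F0 b0.
have := @beta_val_rbinom R p^-1 b p n m0 p0.
rewrite mulVf ?gt_eqF// subrr powRr1 ?(ltW b0)// mul1r => ->.
have := @beta_val_rbinom R p^-1 b q n m0 q0.
rewrite (mulrC p^-1 q) => ->.
move=> H.
have [rbp rbq] := (rb p p0, rb q q0).
set M := #|D|%:R in M0 bq H *.
suff : M * (b / rbinom (n%:R + p) n%:R) <= \sum_t psi t.
  move=> le; have -> : b = rbinom (n%:R + p) n%:R / M
      * (M * (b / rbinom (n%:R + p) n%:R)).
    by field; rewrite (lt0r_neq0 rbp) (lt0r_neq0 M0).
  by apply: ler_wpM2l le; exact: divr_ge0 (ltW rbp) (ltW M0).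
apply: H => //.
- by move=> x /asboolP Kx; rewrite /phi powR_ge0/=; apply: ge0_ler_powR;
    rewrite ?nnegrE ?f_ge0 ?f_max0// ltW.
- by move=> x; rewrite /psi; case: ifP => _; rewrite ?powR_ge0.
- move=> x /asboolP Kx; have Kz i : `|box_point x 0 i - box_point x 0 i| < 1 :> R.
    by rewrite subrr normr0.
  rewrite /phi /psi asboolT; last exact: minkowski_sum_near Kx Kz.
  apply: ge0_ler_powR; rewrite ?nnegrE ?f_ge0 ?diamond_ge0 ?(ltW p0)//.
  exact: diamond_ge.
rewrite (eq_bigr (fun t => f (box_point t) `^ q)); last first.
  move=> t _; rewrite /phi -powRrM; congr (_ `^ _); field; exact: lt0r_neq0.
set S := \sum_(t | _) _ in bq *.
have qp0 : 0 < q / p by exact: lt_trans r1.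
(* Multiplying [bq] by this factor puts it in the form of the strict hypothesis of
   [single_crossing]. *)
have c0 : 0 < M / (q / p * rbinom (n%:R + q) n%:R) by rewrite divr_gt0// mulr_gt0.
have := bq; rewrite -(ltr_pM2l c0); set L := (X in X < _); set U := (X in _ < X).
have -> : L = M * (b `^ (q / p) / (q / p * rbinom (n%:R + q) n%:R)).
  by rewrite /L mulrAC mulrA.
suff -> : U = S / (q / p) by [].
by rewrite /U; field; rewrite !gt_eqF.
Qed.

End BerwaldLattice.

Theorem theorem1p4 (R : realType) (n : nat) (n_ge1 : (1 <= n)%N)
    (K : set 'rV[R]_n) (f : 'rV[R]_n -> R)
    (K_convex : convex_set K) (K_bounded : bounded_set K) (K_0 : K 0)
    (f_ge0 : forall x, K x -> 0 <= f x)
    (f_concave : concave_function K f)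
    (f_max0 : (f 0)%:E = sup_on K f)
    (p q : R) (p_gt0 : 0 < p) (p_lt_q : p < q) :
  (rbinom (n%:R + q) n%:R / (Gn K)%:R
     * \sum_(x \in K `&` int_lattice R n) f x `^ q) `^ q^-1
  <= (rbinom (n%:R + p) n%:R / (Gn K)%:R
        * \sum_(x \in minkowski_sum K (open_cube R n) `&` int_lattice R n)
            diamond K f x `^ p) `^ p^-1.
Proof.
have [k nk] : exists k, n = k.+1 by exists n.-1; rewrite prednK.
subst n; have [m Km] := bounded_coord K_bounded.
have q0 : 0 < q by exact: lt_trans p_lt_q.
have f_le x : K x -> f x <= f 0.
  by move=> Kx; rewrite -lee_fin f_max0; apply: ereal_sup_ubound; exists x.
(* If f(0) = 0, then [f] vanishes on [K] and the left-hand side is 0, because 0 raised to a nonzero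
   power is 0. *)
have := f_ge0 0 K_0; rewrite le_eqVlt => /predU1P[f00|f0_gt0]; last first.
  exact: (berwald_lattice K_convex K_0 f_ge0 f_concave f_le Km).
rewrite [X in (_ * X) `^ _ <= _]fsbig1 => [|x [Kx _]].
  rewrite mulr0 (powR0 (invr_neq0 (lt0r_neq0 q0))).
  exact: powR_ge0.
have -> : f x = 0 by apply/eqP; rewrite eq_le f_ge0// andbT f00 f_le.
by rewrite powR0// gt_eqF.
Qed.
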